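(* Let $\ell\geq 6$ and $d\in\{4,\dots,\ell-1\}$, and let $G$ be a graph of sufficiently large order $n$. (i) If at least one of $\ell$ and $d$ is even, then there exists a tree $F$ of order $\ell$ and diameter $d$ such that ${\rm SPEX}(n,F)=\{G_{n,\ell}\}$. (ii) If both $\ell$ and $d$ are odd and $\rho(G)\geq \rho(S_{n,(\ell-3)/2}^{0})$, then $G$ contains (as a subgraph) every tree of order $\ell$ and diameter $d$, unless $G=S_{n,(\ell-3)/2}^{0}$.
   Context: For a graph $G$, $\rho(G)$ is the largest eigenvalue of its adjacency matrix. For a tree $F$, ${\rm spex}(n,F)$ is the maximum of $\rho(G)$ over all $F$-free graphs on $n$ vertices and ${\rm SPEX}(n,F)$ is the set of $F$-free $n$-vertex graphs attaining it. For integers $n>k>0$ and $0\leq p\leq\lfloor (n-k)/2\rfloor$, $S_{n,k}^{p}$ is the graph obtained from the join $K_k\nabla (n-k)K_1$ (a clique on $k$ vertices, an independent set on $n-k$ vertices, and all edges between them) by adding $p$ pairwise disjoint edges inside the independent set. For $n\geq\ell\geq 4$, $G_{n,\ell}=S_{n,(\ell-2)/2}^{0}$ if $\ell$ is even and $G_{n,\ell}=S_{n,(\ell-3)/2}^{1}$ if $\ell$ is odd. *)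

(* Defs.v *)
From HB Require Import structures.
From mathcomp Require Import all_boot all_order all_algebra.
From mathcomp Require Import all_classical all_reals.

Set Implicit Arguments.
Unset Strict Implicit.
Unset Printing Implicit Defensive.

Import Order.TTheory GRing.Theory Num.Theory.
Local Open Scope classical_set_scope.
Local Open Scope ring_scope.

(* Not [rel 'I_n]: the universe of [rel] would end up in that of [graph n], and
   [set (graph n)] is then incompatible with loading real_closed's complex.v. *)
Record graph (n : nat) := Graph {
  adj : 'I_n -> 'I_n -> bool;
  adj_sym : symmetric adj;
  adj_irr : irreflexive adj
}.

Definition iso (n : nat) (G H : graph n) : Prop :=
  exists2 f : 'I_n -> 'I_n, bijective f &
    forall x y, adj G x y = adj H (f x) (f y).

Definition contains (m n : nat) (G : graph n) (F : graph m) : Prop :=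
  exists2 f : 'I_m -> 'I_n, injective f &
    forall x y, adj F x y -> adj G (f x) (f y).

Definition graph_free (m n : nat) (F : graph m) (G : graph n) : Prop :=
  ~ contains G F.

Definition graph_connected (n : nat) (G : graph n) : Prop :=
  (0 < n)%N /\ forall x y, connect (adj G) x y.

(* The bound on the size excludes [::] and the back-and-forth closed walks
   [:: x; y], both of which satisfy ucycle. *)
Definition acyclic (n : nat) (G : graph n) : Prop :=
  forall c : seq 'I_n, ucycle (adj G) c -> (size c < 3)%N.

Definition tree (n : nat) (G : graph n) : Prop := graph_connected G /\ acyclic G.

Definition walk (n : nat) (G : graph n) (k : nat) (x y : 'I_n) : bool :=
  [exists p : k.-tuple 'I_n, path (adj G) x p && (last x p == y)].

(* The least length of a walk from x to y; it is the junk value n when x and y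
   are in different components. *)
Definition gdist (n : nat) (G : graph n) (x y : 'I_n) : nat :=
  find (fun k => walk G k x y) (iota 0 n).

Definition diameter (n : nat) (G : graph n) : nat :=
  \max_(x < n) \max_(y < n) gdist G x y.

Definition adjmx (R : realType) (n : nat) (G : graph n) : 'M[R]_n :=
  \matrix_(i, j) (adj G i j)%:R.

(* For n > 0 the set of eigenvalues is finite and, the matrix being symmetric,
   non-empty, so that this supremum is the largest eigenvalue. *)
Definition rho (R : realType) (n : nat) (G : graph n) : R :=
  sup [set a : R | eigenvalue (adjmx R G) a].

(* There are finitely many graphs on 'I_n, hence this supremum is a maximum as
   soon as some graph on n vertices is F-free. *)
Definition spex (R : realType) (m n : nat) (F : graph m) : R :=
  sup [set rho R G | G in [set G : graph n | graph_free F G]].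

Definition SPEX (R : realType) (m n : nat) (F : graph m) : set (graph n) :=
  [set G | graph_free F G /\ rho R G = spex R n F].

Arguments spex R {m} n F.
Arguments SPEX R {m} n F.

(* Vertices below k form the clique; the p extra edges join k + 2i and
   k + 2i + 1 for i < p. Meaningful for 0 < k < n and p <= (n - k)./2. *)
Definition Sadj (n k p : nat) : rel 'I_n := fun x y =>
  (x != y) &&
  [|| (x < k)%N, (y < k)%N
    | ((x - k)./2 == (y - k)./2)%N && ((x - k)./2 < p)%N].

Lemma Sadj_sym (n k p : nat) : symmetric (@Sadj n k p).
Proof.
move=> x y; rewrite /Sadj eq_sym; congr (_ && _); rewrite orbCA eq_sym.
by case: (eqVneq (y - k)./2 (x - k)./2) => [->|].
Qed.

Lemma Sadj_irr (n k p : nat) : irreflexive (@Sadj n k p).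
Proof. by move=> x; rewrite /Sadj eqxx. Qed.

Definition Sgraph (n k p : nat) : graph n :=
  Graph (@Sadj_sym n k p) (@Sadj_irr n k p).

Definition Ggraph (n l : nat) : graph n :=
  if odd l then Sgraph n (l - 3)./2 1 else Sgraph n (l - 2)./2 0.

(* Main.v *)
Require Import Defs.
From mathcomp Require Import all_classical all_reals.
From mathcomp Require Import all_boot all_order all_algebra.
From mathcomp Require Import zify ring lra.

(* Let k be the number of clique vertices of the extremal graph and let x be a
   nonnegative eigenvector for rho(G) with maximum 1, where G is free of a tree F
   on l <= 2k + 3 vertices.  Such a G is l-degenerate and contains no K_{k+1,l}.
   Since rho(G)^2 >= k(n - k), counting walks of length two shows that for fixed
   eta only boundedly many entries of x exceed eta, that all but boundedly many
   vertices have at most k neighbours among these, and hence that some vertex has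
   exactly k such neighbours, with entries close to 1 and degrees close to n.
   They form a set W; let C be its common neighbourhood.  Comparing the quadratic
   form of G with that of the graph G' in which W is a clique joined to everything
   and the only other edges are those of G inside C, the gain from the missing
   W-edges beats the loss, as every vertex outside W has a tiny entry and few
   neighbours in C.  So rho(G) >= rho(G') forces G = G'.

   It remains to see which edges inside C are compatible with F-freeness.  If a
   colour class of F of size at most k + 1 contains a leaf, then mapping the other
   vertices of that class to W embeds F as soon as C spans an edge.  Such a leaf
   exists if F has even order, and also if F has odd order and odd diameter, since
   the ends of a diametral path are then leaves of different colours.  For odd
   order and even diameter a spider with legs of even length leaves room for
   exactly one edge.  Spiders also serve as F for even order. *)

Set Implicit Arguments.
Unset Strict Implicit.
Unset Printing Implicit Defensive.
Import Order.TTheory GRing.Theory Num.Theory.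
Local Open Scope ring_scope.

(** * Symmetric forms and the largest eigenvalue *)

Section QuadraticForms.
Variables (R : realType) (n : nat).
Implicit Types (u v : 'rV[R]_n) (M A : 'M[R]_n).

Definition bform M u v : R := (u *m M *m v^T) 0 0.

Lemma bformE M u v : bform M u v = \sum_i \sum_j u 0 i * M i j * v 0 j.
Proof.
rewrite /bform mxE exchange_big /=; apply: eq_bigr => j _.
by rewrite !mxE big_distrl.
Qed.

Lemma bform1E u v : bform 1%:M u v = \sum_i u 0 i * v 0 i.
Proof. by rewrite /bform mulmx1 mxE; apply: eq_bigr => i _; rewrite mxE. Qed.

Lemma bform1_ge0 v : 0 <= bform 1%:M v v.
Proof. by rewrite bform1E sumr_ge0 // => i _; rewrite -expr2 sqr_ge0. Qed.

Lemma bform1_eq0 v : bform 1%:M v v = 0 -> v = 0.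
Proof.
rewrite bform1E => h; apply/rowP => i; rewrite mxE; apply/eqP.
rewrite -sqrf_eq0 expr2; move/eqP: h.
rewrite psumr_eq0 => [|j _]; last by rewrite -expr2 sqr_ge0.
by move/allP/(_ i); rewrite mem_index_enum => /(_ isT).
Qed.

Lemma bform_sym M u v : M^T = M -> bform M u v = bform M v u.
Proof.
move=> hM; have -> : bform M u v = (u *m M *m v^T)^T 0 0 by rewrite [RHS]mxE.
by rewrite /bform !trmx_mul trmxK hM mulmxA.
Qed.

Lemma bform_scalarB A (m : R) u v :
  bform (m%:M - A) u v = m * bform 1%:M u v - bform A u v.
Proof.
rewrite /bform mulmxBr mulmxBl mul_mx_scalar mulmx1 -scalemxAl.
by move: (u *m v^T) (u *m A *m v^T) => X Y; rewrite !mxE.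
Qed.

Lemma bform_add M u v s : M^T = M ->
  bform M (u + s *: v) (u + s *: v)
  = bform M u u + 2 * s * bform M u v + s ^+ 2 * bform M v v.
Proof.
move=> hM; have := bform_sym v u hM; rewrite /bform => hs.
rewrite linearD linearZ /= !mulmxDl !mulmxDr -!scalemxAl -!scalemxAr.
move: (u *m M *m u^T) (u *m M *m v^T) (v *m M *m u^T) (v *m M *m v^T) hs.
by move=> X Y Z T hs; rewrite !mxE hs; ring.
Qed.

(** The polynomial [bform M (u + s *: v) (u + s *: v)] in [s] is nonnegative, so its discriminant is
    not positive. *)
Lemma psd_cauchy M u v : M^T = M -> (forall w, 0 <= bform M w w) ->
  bform M u v ^+ 2 <= bform M u u * bform M v v.
Proof.
move=> hM h; have hs s : 0 <= bform M u u + 2 * s * bform M u v + s ^+ 2 * bform M v v.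
  by rewrite -bform_add.
move: (h u) (h v) hs; move: (bform M u u) (bform M u v) (bform M v v) => a b c ha hc hs.
have [c0|c0] := eqVneq c 0.
  have [->|b0] := eqVneq b 0; first by rewrite expr0n mulr_ge0.
  (* With zero leading coefficient the polynomial is affine in [s]; this [s] gives it the value
     -1. *)
  have := hs (- (a + 1) / (2 * b)); rewrite c0 mulr0 addr0.
  have -> : a + 2 * (- (a + 1) / (2 * b)) * b = -1 by field.
  by lra.
have cp : 0 < c by rewrite lt_def c0.
(* The minimiser of the quadratic in [s]. *)
have := hs (- b / c).
have -> : a + 2 * (- b / c) * b + (- b / c) ^+ 2 * c = (a * c - b ^+ 2) / c by field.
by rewrite pmulr_lge0 ?invr_gt0 // subr_ge0.
Qed.

Lemma bform_bounded M : exists2 C : R, 0 < C & forall v, bform M v v <= C * bform 1%:M v v.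
Proof.
pose K := \sum_i \sum_j `|M i j|.
have hK : 0 <= K by apply: sumr_ge0 => i _; apply: sumr_ge0.
exists (K + 1) => [|v]; first by lra.
apply: (@le_trans _ _ (K * bform 1%:M v v)); last first.
  by have := bform1_ge0 v; nra.
rewrite bformE /K big_distrl /=; apply: ler_sum => i _.
rewrite big_distrl /=; apply: ler_sum => j _.
have hi l : (v 0 l) ^+ 2 <= bform 1%:M v v.
  rewrite bform1E (bigD1 l) //= expr2 lerDl; apply: sumr_ge0 => m _.
  by rewrite -expr2 sqr_ge0.
apply: (le_trans (ler_norm _)); rewrite !normrM mulrAC mulrC.
apply: ler_wpM2l => //.
have := hi i; have := hi j; rewrite -(real_normK (num_real (v 0 i))).
rewrite -(real_normK (num_real (v 0 j))).
by have := sqr_ge0 (`|v 0 i| - `|v 0 j|); nra.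
Qed.

(** Take the least [m] for which [m%:M - A] is positive semidefinite. Were this matrix invertible,
    it would dominate a positive multiple of the identity, and [m] could be lowered. This replaces
    compactness of the unit sphere. *)
Lemma top_eigenvalue A : (0 < n)%N -> A^T = A ->
  exists m : R, eigenvalue A m /\ forall v, bform A v v <= m * bform 1%:M v v.
Proof.
move=> n0 hA; pose i0 := Ordinal n0.
pose S : set R := fun m => forall v, bform A v v <= m * bform 1%:M v v.
have [C _ hC] := bform_bounded A.
pose e := delta_mx 0 i0 : 'rV[R]_n.
have he : bform 1%:M e e = 1.
  rewrite bform1E (bigD1 i0) //= big1 ?addr0 => [|i hi].
    by rewrite !mxE !eqxx mulr1.
  by rewrite !mxE (negbTE hi) andbF mul0r.
have S0 : (S !=set0)%classic by exists C.
have lbS : has_lbound S by exists (bform A e e) => m /(_ e); rewrite he mulr1.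
have Sinf : S (inf S).
  move=> v; have [v0|v0] := eqVneq (bform 1%:M v v) 0.
    have := hC v; by rewrite v0 !mulr0.
  have vp : 0 < bform 1%:M v v by rewrite lt_def v0 bform1_ge0.
  rewrite -ler_pdivrMr //; apply: lb_le_inf => // m /(_ v).
  by rewrite ler_pdivrMr.
exists (inf S); split => //; apply: contraT => hne.
pose M := (inf S)%:M - A.
have hM : M^T = M by rewrite /M linearB /= tr_scalar_mx hA.
have psdM v : 0 <= bform M v v by rewrite bform_scalarB subr_ge0; apply: Sinf.
have uM : M \in unitmx.
  rewrite -row_free_unit -kermx_eq0; apply: contraR hne => /rowV0Pn[v].
  rewrite sub_kermx => /eqP hv v0; apply/eigenvalueP; exists v => //.
  by move/eqP: hv; rewrite /M mulmxBr mul_mx_scalar subr_eq0 => /eqP.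
have [C' C'0 hC'] := bform_bounded (invmx M).
(* Cauchy-Schwarz for [M] between [v] and [v *m invmx M], whose mixed term is the squared norm of
   [v]. *)
have low v : bform 1%:M v v <= C' * bform M v v.
  have := psd_cauchy v (v *m invmx M) hM psdM.
  have hi : (invmx M)^T = invmx M by rewrite trmx_inv hM.
  have -> : bform M v (v *m invmx M) = bform 1%:M v v.
    by rewrite /bform trmx_mul hi -!mulmxA (mulmxA M) mulmxV // mul1mx.
  have -> : bform M (v *m invmx M) (v *m invmx M) = bform (invmx M) v v.
    by rewrite /bform mulmxKV // trmx_mul hi mulmxA.
  have := hC' v; have := psdM v; have := bform1_ge0 v.
  move: (bform 1%:M v v) (bform M v v) (bform (invmx M) v v) => a b c a0 b0 h1 h2.
  have [->|an0] := eqVneq a 0; first by rewrite mulr_ge0 // ltW.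
  have ap : 0 < a by rewrite lt_def an0.
  have : a * a <= a * (C' * b).
    rewrite -expr2; apply: (le_trans h2); apply: (le_trans (ler_wpM2l b0 h1)).
    by have -> : b * (C' * a) = a * (C' * b) by ring.
  by rewrite ler_pM2l.
have : inf S <= inf S - C'^-1.
  apply: (ge_inf lbS) => v; have := low v; rewrite bform_scalarB mulrBl.
  rewrite mulrC -ler_pdivrMr // mulrC; lra.
have : 0 < C'^-1 by rewrite invr_gt0.
by lra.
Qed.

End QuadraticForms.

(** * Rayleigh quotients and nonnegative eigenvectors *)

Section SpectralRadius.
Variables (R : realType) (n : nat).
Implicit Types (G H : graph n) (x y : 'I_n -> R).

Definition qform G x : R := \sum_i \sum_j (adj G i j)%:R * x i * x j.

Definition eigenfun G x :=
  forall i, \sum_j (adj G i j)%:R * x j = rho R G * x i.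

Lemma adjmx_sym G : (adjmx R G)^T = adjmx R G.
Proof. by apply/matrixP => i j; rewrite !mxE adj_sym. Qed.

Lemma bform_adjmx G x : bform (adjmx R G) (\row_i x i) (\row_i x i) = qform G x.
Proof.
rewrite bformE; apply: eq_bigr => i _; apply: eq_bigr => j _.
by rewrite !mxE; ring.
Qed.

Lemma bform1_row x : bform 1%:M (\row_i x i) (\row_i x i) = \sum_i x i ^+ 2.
Proof. by rewrite bform1E; apply: eq_bigr => i _; rewrite !mxE expr2. Qed.

(** The number from [top_eigenvalue] bounds every eigenvalue, as the form at an eigenvector shows,
    so it is the supremum defining [rho]. *)
Lemma rho_spec G : (0 < n)%N ->
  eigenvalue (adjmx R G) (rho R G)
  /\ forall v, bform (adjmx R G) v v <= rho R G * bform 1%:M v v.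
Proof.
move=> n0; have [m [em hm]] := top_eigenvalue n0 (adjmx_sym G).
suff -> : rho R G = m by [].
have ub : ubound [set a : R | eigenvalue (adjmx R G) a]%classic m.
  move=> a /= /eigenvalueP[v hv v0]; have := hm v.
  have -> : bform (adjmx R G) v v = a * bform 1%:M v v.
    rewrite /bform hv mulmx1 -scalemxAl; move: (v *m v^T) => X.
    by rewrite mxE.
  rewrite ler_pM2r // lt_def bform1_ge0 andbT.
  by apply: contraNneq v0 => /bform1_eq0 ->.
apply: le_anti; apply/andP; split; first by apply: ge_sup => //; exists m.
by apply: sup_upper_bound => //; split; exists m.
Qed.

Lemma rayleigh G x : (0 < n)%N -> qform G x <= rho R G * \sum_i x i ^+ 2.
Proof.
by move=> n0; have [_ h] := rho_spec G n0; rewrite -bform_adjmx -bform1_row.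
Qed.

(** Equality case of [rayleigh]: [x] is isotropic for the semidefinite matrix [M], so by
    Cauchy-Schwarz it is [M]-orthogonal to every basis vector. *)
Lemma rayleigh_eigenfun G x : (0 < n)%N ->
  rho R G * (\sum_i x i ^+ 2) <= qform G x -> eigenfun G x.
Proof.
move=> n0 hx i; have [_ h] := rho_spec G n0.
pose M := (rho R G)%:M - adjmx R G.
have hM : M^T = M by rewrite /M linearB /= tr_scalar_mx adjmx_sym.
have psdM v : 0 <= bform M v v by rewrite bform_scalarB subr_ge0.
pose v := \row_i x i.
have hv : bform M v v <= 0 by rewrite bform_scalarB subr_le0 bform_adjmx bform1_row.
have := psd_cauchy v (delta_mx 0 i) hM psdM.
have -> : bform M v v = 0 by apply: le_anti; rewrite hv psdM.
rewrite mul0r => h0; have {h0} : bform M v (delta_mx 0 i) = 0.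
  by apply/eqP; rewrite -sqrf_eq0 eq_le h0 sqr_ge0.
rewrite /bform trmx_delta -colE mxE /M mulmxBr mul_mx_scalar.
move=> /eqP; rewrite !mxE subr_eq0 => /eqP ->.
by apply: eq_bigr => j _; rewrite !mxE adj_sym mulrC.
Qed.

Lemma qform_eigenfun G x : eigenfun G x -> qform G x = rho R G * \sum_i x i ^+ 2.
Proof.
move=> hx; rewrite /qform big_distrr /=; apply: eq_bigr => i _.
rewrite expr2 mulrA -hx big_distrl /=; apply: eq_bigr => j _.
by rewrite mulrAC.
Qed.

(** Absolute values keep the norm of an eigenvector and do not lower the form, so the equality case
    applies; dividing by the largest entry normalises. As [G] may be disconnected, entries may
    vanish. *)
Lemma perron G : (0 < n)%N -> exists x, [/\ forall i, 0 <= x i <= 1,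
  exists i, x i = 1 & eigenfun G x].
Proof.
move=> n0; have [/eigenvalueP[v hv v0] h] := rho_spec G n0.
have hE i : \sum_j (adj G i j)%:R * v 0 j = rho R G * v 0 i.
  have := congr1 (fun w : 'rV_n => w 0 i) hv; rewrite !mxE => <-.
  by apply: eq_bigr => j _; rewrite !mxE adj_sym mulrC.
pose y i := `|v 0 i|.
have hy : eigenfun G y.
  apply: rayleigh_eigenfun => //.
  have -> : \sum_i y i ^+ 2 = \sum_i v 0 i ^+ 2.
    by apply: eq_bigr => i _; rewrite real_normK ?num_real.
  rewrite -(@qform_eigenfun G (fun i => v 0 i) hE).
  apply: ler_sum => i _; apply: ler_sum => j _; rewrite -!mulrA.
  by apply: ler_wpM2l => //; rewrite /y -normrM ler_norm.
pose i0 := [arg max_(i > Ordinal n0) y i]%O.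
have hmax i : y i <= y i0 by rewrite /i0; case: arg_maxP => // j _; apply.
have ypos : 0 < y i0.
  rewrite lt_def normr_ge0 andbT; apply: contra v0 => /eqP y0.
  apply/eqP/rowP => i; rewrite mxE; apply/eqP; rewrite -normr_eq0.
  by rewrite eq_le normr_ge0 andbT -y0 hmax.
exists (fun i => y i / y i0); split.
- by move=> i; rewrite divr_ge0 ?normr_ge0 //= ler_pdivrMr // mul1r hmax.
- by exists i0; rewrite divff // gt_eqF.
move=> i; rewrite mulrA -hy big_distrl /=; apply: eq_bigr => j _.
by rewrite mulrA.
Qed.

(** The Perron vector of [G], transported along the inverse of [f], is a test vector for [H]. *)
Lemma rho_le_morph G H (f : 'I_n -> 'I_n) : (0 < n)%N -> injective f ->
  (forall i j, adj G i j -> adj H (f i) (f j)) -> rho R G <= rho R H.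
Proof.
move=> n0 finj hf; have [x [x01 [i xi] hx]] := perron G n0.
have [g fK gK] := injF_bij finj.
have hsum (F : 'I_n -> R) : \sum_j F (g j) = \sum_j F j.
  by rewrite [LHS](reindex f) /=; [apply: eq_bigr => j _; rewrite fK|exists g => j _].
have x2 : 0 < \sum_i x i ^+ 2.
  rewrite (bigD1 i) //= xi expr1n ltr_pwDl // sumr_ge0 // => j _.
  by rewrite sqr_ge0.
rewrite -(ler_pM2r x2) -(qform_eigenfun hx).
have := rayleigh H (x \o g) n0; rewrite /= (hsum (fun j => x j ^+ 2)); apply: le_trans.
rewrite /qform -[leLHS](hsum (fun i => \sum_j (adj G i j)%:R * x i * x j)).
apply: ler_sum => a _.
rewrite -[leLHS](hsum (fun j => (adj G (g a) j)%:R * x (g a) * x j)); apply: ler_sum => b _ /=.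
have [/andP[a0 _] /andP[b0 _]] := (x01 (g a), x01 (g b)).
rewrite -!mulrA; apply: ler_wpM2r; first exact: mulr_ge0.
rewrite ler_nat; case e: (adj G _ _) => //.
by have := hf _ _ e; rewrite !gK => ->.
Qed.

Lemma rho_iso G H : (0 < n)%N -> iso G H -> rho R G = rho R H.
Proof.
move=> n0 [f [g fK gK] hf]; apply: le_anti; apply/andP; split.
  by apply: (@rho_le_morph _ _ f n0 (can_inj fK)) => i j; rewrite hf.
by apply: (@rho_le_morph _ _ g n0 (can_inj gK)) => i j; rewrite hf !gK.
Qed.

End SpectralRadius.

(** * Degeneracy, common neighbourhoods and edge counts *)

Section Neighbourhoods.
Variables (n : nat) (G : graph n).

Definition nb (v : 'I_n) : {set 'I_n} := [set u | adj G v u].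
Definition common (Y : {set 'I_n}) : {set 'I_n} := [set v | Y \subset nb v].

Definition degenerate T :=
  forall S : {set 'I_n}, S != set0 -> exists2 v, v \in S & (#|nb v :&: S| <= T)%N.

(** The absence of a subgraph [K_{k+1,T}]. *)
Definition bipartite_free k T :=
  forall Y : {set 'I_n}, (k < #|Y|)%N -> (#|common Y| < T)%N.

Lemma adj_common (Y : {set 'I_n}) w v : w \in Y -> v \in common Y -> adj G v w.
Proof. by move=> wY; rewrite inE => /subsetP/(_ _ wY); rewrite inE. Qed.

Lemma common_notin (Y : {set 'I_n}) v : v \in common Y -> v \notin Y.
Proof. by move=> h; apply/negP => /adj_common/(_ h); rewrite adj_irr. Qed.

Variable R : realType.
Implicit Types (y : 'I_n -> R) (S : {set 'I_n}).

Lemma sum_adj S v y :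
  \sum_(w in S) (adj G v w)%:R * y w = \sum_(w in nb v :&: S) y w.
Proof.
rewrite big_mkcond [RHS]big_mkcond; apply: eq_bigr => w _.
by rewrite !inE; case: (adj G v w); case: (w \in S); rewrite ?mul1r ?mul0r.
Qed.

Lemma sum_le_card S (c : R) y : (forall w, w \in S -> y w <= c) ->
  \sum_(w in S) y w <= #|S|%:R * c.
Proof.
move=> h; rewrite mulr_natl -sumr_const.
by apply: ler_sum.
Qed.

(** Induction on the size of [S]: a vertex [v] with at most [T] neighbours in [S] contributes, by
    its row and its column, at most [2 * T%:R * c * y v], and is then deleted. *)
Lemma degenerate_sum T S (c : R) y : degenerate T -> 0 <= c ->
  (forall v, v \in S -> 0 <= y v <= c) ->
  \sum_(u in S) \sum_(v in S) (adj G u v)%:R * y u * y v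
    <= 2 * T%:R * c * \sum_(u in S) y u.
Proof.
move=> hT c0; have [m] := ubnP #|S|; elim: m S => // m IH S.
have [->|S0 Sm hy] := eqVneq S set0; first by rewrite !big_set0 mulr0.
have [v vS hv] := hT S S0.
have {}IH := IH (S :\ v).
rewrite [leLHS](big_setD1 v vS) /= [X in _ + X](eq_bigr (fun u =>
   (adj G v u)%:R * y u * y v +
   \sum_(w in S :\ v) (adj G u w)%:R * y u * y w)); last first.
  by move=> u _; rewrite (big_setD1 v vS) /= adj_sym.
rewrite big_split /= addrA [X in _ + X <= _](_ : _ = \sum_(u in S :\ v)
   \sum_(w in S :\ v) (adj G u w)%:R * y u * y w) // [leRHS](_ : _ =
   2 * T%:R * c * y v + 2 * T%:R * c * \sum_(u in S :\ v) y u); last first.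
  by rewrite (big_setD1 v vS) /= mulrDr.
apply: lerD; last first.
  apply: IH => [|w]; last by rewrite inE => /andP[_]; apply: hy.
  by move: Sm; rewrite (cardsD1 v S) vS.
have -> : \sum_(w in S) (adj G v w)%:R * y v * y w
        = y v * \sum_(w in S) (adj G v w)%:R * y w.
  by rewrite big_distrr /=; apply: eq_bigr => w _; ring.
have -> : \sum_(w in S :\ v) (adj G v w)%:R * y w * y v
        = y v * \sum_(w in S) (adj G v w)%:R * y w.
  rewrite (big_setD1 v vS) /= adj_irr mul0r add0r big_distrr /=.
  by apply: eq_bigr => w _; ring.
have : \sum_(w in S) (adj G v w)%:R * y w <= T%:R * c.
  rewrite sum_adj; apply: (@le_trans _ _ (#|nb v :&: S|%:R * c)).
    by apply: sum_le_card => w; rewrite inE => /andP[_ /hy/andP[]].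
  by rewrite ler_wpM2r // ler_nat.
have /andP[y0 _] := hy v vS.
move: (\sum_(w in S) _) => s hs.
have : y v * s <= y v * (T%:R * c) by apply: ler_wpM2l.
by move=> h; nra.
Qed.

Lemma degenerate_edges T S : degenerate T ->
  \sum_(u in S) \sum_(v in S) (adj G u v)%:R <= 2 * T%:R * #|S|%:R :> R.
Proof.
move=> hT; have := @degenerate_sum T S 1 (fun=> 1) hT ler01.
rewrite sumr_const mulr1 => h; apply: le_trans (h _); last first.
  by move=> v _; rewrite ler01 lexx.
by apply: ler_sum => u _; apply: ler_sum => v _; rewrite !mulr1.
Qed.

Lemma card_nb_sum v : #|nb v|%:R = \sum_w (adj G v w)%:R :> R.
Proof.
rewrite -sum1_card natr_sum big_mkcond; apply: eq_bigr => w _.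
by rewrite inE; case: (adj G v w).
Qed.

Lemma sum_deg_le T S : degenerate T ->
  \sum_(v in S) #|nb v|%:R <= 2 * T%:R * n%:R :> R.
Proof.
move=> hT; have := degenerate_edges setT hT; rewrite cardsT card_ord.
apply: le_trans; rewrite big_mkcond /= [leRHS]big_mkcond.
apply: ler_sum => v _; rewrite in_setT; case: ifP => _.
  rewrite card_nb_sum big_mkcond [leRHS]big_mkcond /=.
  by apply: ler_sum => w _; rewrite in_setT.
by apply: sumr_ge0.
Qed.

End Neighbourhoods.

(** * Walks of length two and large eigenvector entries *)

Section LargeEntries.
Variables (R : realType) (n : nat) (G : graph n) (k T : nat).
Variables (x : 'I_n -> R) (lam : R).
Hypotheses (k_gt0 : (0 < k)%N) (T_gt0 : (0 < T)%N).
Hypothesis dG : degenerate G T.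
Hypothesis bG : bipartite_free G k T.
Hypothesis x01 : forall i, 0 <= x i <= 1.
Hypothesis xE : forall i, \sum_j (adj G i j)%:R * x j = lam * x i.
Hypothesis lam_ge0 : 0 <= lam.
Hypothesis lam2 : k%:R * (n%:R - k%:R) <= lam ^+ 2.

Local Notation nb := (nb G).
Local Notation large a := [set w | a <= x w].
Local Notation weight L u := (\sum_(w in L) (adj G u w)%:R * x w).

Let x_ge0 i : 0 <= x i. Proof. by have /andP[] := x01 i. Qed.
Let x_le1 i : x i <= 1. Proof. by have /andP[] := x01 i. Qed.
Let k_ge1 : 1 <= k%:R :> R. Proof. by rewrite ler1n. Qed.
Let T_ge1 : 1 <= T%:R :> R. Proof. by rewrite ler1n. Qed.

(** Makes [lam] exceed any prescribed constant for large [n], since [lam ^+ 2] is at least [n - k],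
    hence at least [n / 2]. *)
Lemma lam_ge (M : R) : 0 <= M -> 2 * k%:R <= n%:R :> R -> 2 * M ^+ 2 <= n%:R ->
  M <= lam.
Proof.
move=> M0 h1 h2; rewrite -ler_sqr ?nnegrE //; apply: le_trans lam2.
have : n%:R - k%:R <= k%:R * (n%:R - k%:R) :> R.
  by rewrite ler_peMl //; have := k_ge1; lra.
lra.
Qed.

(* Walks of length two from [v], split according to whether they end in [L]. *)
Lemma two_walks (L : {set 'I_n}) (a : R) v : 0 <= a ->
  (forall w, w \notin L -> x w <= a) ->
  lam ^+ 2 * x v <= \sum_(u in nb v) weight L u + 2 * T%:R * n%:R * a.
Proof.
move=> a0 hL.
have -> : lam ^+ 2 * x v = \sum_(u in nb v) \sum_w (adj G u w)%:R * x w.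
  rewrite expr2 -mulrA -xE big_distrr /= [RHS]big_mkcond; apply: eq_bigr => u _.
  rewrite inE; case: (adj G v u); last by rewrite mul0r mulr0.
  by rewrite mul1r -xE.
have -> : \sum_(u in nb v) \sum_w (adj G u w)%:R * x w =
   \sum_(u in nb v) weight L u + \sum_(u in nb v) weight (~: L) u.
  rewrite -big_split; apply: eq_bigr => u _ /=.
  rewrite (bigID (mem L)) /=; congr (_ + _).
  by apply: eq_bigl => w; rewrite inE.
rewrite lerD2l; apply: (@le_trans _ _ (\sum_(u in nb v) #|nb u|%:R * a)).
  apply: ler_sum => u _; rewrite sum_adj.
  apply: (@le_trans _ _ (#|nb u :&: ~: L|%:R * a)).
    by apply: sum_le_card => w; rewrite !inE => /andP[_ /hL].
  by rewrite ler_wpM2r // ler_nat subset_leq_card // subsetIl.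
by rewrite -big_distrl /= ler_wpM2r // sum_deg_le.
Qed.

(** All entries are at most 1, so an entry of at least [a] forces degree at least [lam * a]; the
    degrees sum to at most [2 * T%:R * n%:R]. *)
Lemma large_card (a : R) : #|large a|%:R * (lam * a) <= 2 * T%:R * n%:R.
Proof.
apply: le_trans (sum_deg_le R (large a) dG).
rewrite mulr_natl -sumr_const; apply: ler_sum => w; rewrite inE => aw.
apply: (@le_trans _ _ (lam * x w)); first exact: ler_wpM2l.
rewrite -xE card_nb_sum; apply: ler_sum => u _.
by rewrite ler_piMr.
Qed.

Lemma large_notin (a : R) w : w \notin large a -> x w <= a.
Proof. by rewrite inE -ltNge => /ltW. Qed.

(** Walks ending in entries below [a] contribute at most [k eta n / 8]; the others are bounded by
    the adjacent ordered pairs inside [nb v :|: large a], at most [2 T (deg v + a n)]. As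
    [lam ^+ 2 * x v] is at least [3 k eta n / 4], the degree of [v] must account for the rest. *)
Lemma deg_large (eta a : R) v : 0 < eta -> 16 * T%:R * a = k%:R * eta ->
  4 * k%:R <= n%:R :> R -> 2 * (2 * T%:R / a ^+ 2) ^+ 2 <= n%:R ->
  eta <= x v -> eta * n%:R <= 4 * T%:R * #|nb v|%:R.
Proof.
move=> eta0 ha hn1 hn2 hv.
have Tp : 0 < T%:R :> R by rewrite ltr0n.
have kp : 0 < k%:R :> R by rewrite ltr0n.
have a0 : 0 < a.
  have : 0 < 16 * T%:R * a by rewrite ha mulr_gt0.
  by rewrite pmulr_rgt0 // mulr_gt0 // ltr0n.
have hM : 2 * T%:R / a ^+ 2 <= lam.
  apply: lam_ge => //; first by apply: divr_ge0; [apply: mulr_ge0|apply: sqr_ge0].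
  by have := k_ge1; lra.
have hM2 : 2 * T%:R <= lam * a ^+ 2 by rewrite -ler_pdivrMr // exprn_gt0.
have n0 : 0 <= n%:R :> R by [].
have la0 : 0 < lam * a.
  have : 0 < lam * a * a by rewrite -mulrA -expr2; lra.
  by rewrite pmulr_lgt0.
(* By [hM2], [lam] is large enough to turn the bound of [large_card] into [a * n%:R]. *)
have cL : #|large a|%:R <= a * n%:R :> R.
  rewrite -(ler_pM2r la0); apply: (le_trans (large_card a)).
  have -> : a * n%:R * (lam * a) = (lam * a ^+ 2) * n%:R by ring.
  by rewrite ler_wpM2r.
have := two_walks v (ltW a0) (@large_notin a).
have : \sum_(u in nb v) weight (large a) u
    <= 2 * T%:R * (#|nb v|%:R + #|large a|%:R).
  pose S := nb v :|: large a.
  apply: (@le_trans _ _ (\sum_(u in S) \sum_(w in S) (adj G u w)%:R)).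
    apply: (@le_trans _ _ (\sum_(u in nb v) \sum_(w in S) (adj G u w)%:R)).
      apply: ler_sum => u _; rewrite big_mkcond [leRHS]big_mkcond.
      apply: ler_sum => w _; rewrite in_setU orbC; case: (w \in large a) => /=.
        by rewrite ler_piMr.
      by case: ifP.
    rewrite big_mkcond [leRHS]big_mkcond; apply: ler_sum => u _.
    rewrite in_setU; case: (u \in nb v) => //=.
    by case: ifP => _ //; apply: sumr_ge0.
  apply: (le_trans (degenerate_edges R S dG)).
  rewrite ler_wpM2l ?mulr_ge0 // -natrD ler_nat.
  by rewrite /S cardsU leq_subr.
set s := \sum_(u in nb v) _ => hs1 hs2.
have hnk : 0 <= n%:R - k%:R :> R by lra.
have : k%:R * (n%:R - k%:R) * eta <= lam ^+ 2 * x v.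
  by apply: ler_pM => //; [apply: mulr_ge0|apply: ltW].
have h4 : 4 * (k%:R * k%:R * eta) <= k%:R * eta * n%:R.
  have -> : 4 * (k%:R * k%:R * eta) = k%:R * eta * (4 * k%:R) by ring.
  by apply: ler_wpM2l => //; apply: mulr_ge0 => //; apply: ltW.
have hTL : 2 * T%:R * #|large a|%:R <= 2 * T%:R * (a * n%:R).
  by rewrite ler_wpM2l // mulr_ge0.
have hTa : 16 * (T%:R * a * n%:R) = k%:R * eta * n%:R by rewrite -ha; ring.
have h5 : eta * n%:R <= k%:R * eta * n%:R.
  by rewrite -mulrA ler_peMl // mulr_ge0 // ltW.
move: hs1 hs2 h4 hTL hTa h5; move: (#|nb v|%:R) (#|large a|%:R) => d c.
by move=> *; nra.
Qed.

Lemma deg_card_large (eta : R) (L : {set 'I_n}) : 0 < eta -> (0 < n)%N ->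
  (forall v, v \in L -> eta * n%:R <= 4 * T%:R * #|nb v|%:R) ->
  #|L|%:R * eta <= 8 * T%:R ^+ 2.
Proof.
move=> eta0 n0 h; have np : 0 < n%:R :> R by rewrite ltr0n.
rewrite -(ler_pM2r np).
apply: (@le_trans _ _ (\sum_(v in L) 4 * T%:R * #|nb v|%:R)).
  by rewrite -mulrA [leLHS]mulr_natl -sumr_const; apply: ler_sum => v; apply: h.
rewrite -big_distrr /=.
have -> : 8 * T%:R ^+ 2 * n%:R = 4 * T%:R * (2 * T%:R * n%:R) :> R by ring.
by rewrite ler_wpM2l ?mulr_ge0 // sum_deg_le.
Qed.

(** Such a vertex lies in [common G Y] for its set [Y] of more than [k] neighbours in [L]. There are
    at most [2 ^ #|L|] such sets, each with fewer than [T] common neighbours. *)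
Lemma many_nb_card (L : {set 'I_n}) :
  (#|[set u | k < #|nb u :&: L|]| <= 2 ^ #|L| * T)%N.
Proof.
apply: (@leq_trans #|\bigcup_(Y in powerset L | (k < #|Y|)%N) common G Y|).
  apply: subset_leq_card; apply/subsetP => u; rewrite inE => hu.
  apply/bigcupP; exists (nb u :&: L); first by rewrite powersetE subsetIr hu.
  by rewrite inE subsetIl.
apply: (@leq_trans (\sum_(Y in powerset L | (k < #|Y|)%N) #|common G Y|)).
  elim/big_rec2: _ => [|Y m S _ h]; first by rewrite cards0.
  by rewrite (leq_trans (leq_card_setU _ _)) // leq_add2l.
apply: (@leq_trans (\sum_(Y in powerset L) T)); last first.
  by rewrite sum_nat_const card_powerset.
rewrite big_mkcondr /=; apply: leq_sum => Y _.
by case: ifP => // hY; apply/ltnW/bG.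
Qed.

Lemma weight_le (L : {set 'I_n}) u : weight L u <= #|nb u :&: L|%:R.
Proof.
by rewrite sum_adj -[leRHS]mulr1; apply: sum_le_card => w _; apply: x_le1.
Qed.

(** Refines [two_walks]: a vertex with at most [k] neighbours in [L] counts at most [K], and the
    exceptions bounded by [many_nb_card] count at most [#|L|] more each. *)
Lemma walks_typical (L : {set 'I_n}) (a K : R) v : 0 <= a -> 0 <= K ->
  (forall w, w \notin L -> x w <= a) ->
  (forall u, (#|nb u :&: L| <= k)%N -> weight L u <= K) ->
  lam ^+ 2 * x v
    <= K * #|nb v|%:R + (#|L| * (2 ^ #|L| * T))%:R + 2 * T%:R * n%:R * a.
Proof.
move=> a0 K0 hL hK; apply: (le_trans (two_walks v a0 hL)); rewrite lerD2r.
pose B := [set u | k < #|nb u :&: L|]%N.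
have h u : weight L u <= K + (u \in B)%:R * #|L|%:R.
  rewrite inE; case: ltnP => hu; last by rewrite mul0r addr0 hK.
  rewrite mul1r (le_trans (weight_le L u)) // -[leLHS]add0r lerD // ler_nat.
  by rewrite subset_leq_card // subsetIr.
apply: (@le_trans _ _ (\sum_(u in nb v) (K + (u \in B)%:R * #|L|%:R))).
  by apply: ler_sum.
rewrite big_split /=.
have -> : \sum_(u in nb v) K = K * #|nb v|%:R by rewrite sumr_const mulr_natr.
rewrite lerD2l -big_distrl /= mulrC natrM.
apply: ler_wpM2l => //; apply: (@le_trans _ _ #|B|%:R); last first.
  by rewrite ler_nat many_nb_card.
rewrite -sum1_card natr_sum big_mkcond [leRHS]big_mkcond.
by apply: ler_sum => u _; case: (u \in nb v); case: (u \in B).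
Qed.

End LargeEntries.

(** * The dominating set [W] *)

Lemma nat_above (R : realType) (a : R) : exists N : nat, a <= N%:R.
Proof.
exists (Num.bound `|a|); apply: (le_trans (ler_norm a)).
by apply/ltW/archi_boundP.
Qed.

(** Some vertex [u] has at most [k] neighbours with large entries, yet the total of these entries is
    at least [k - eps]; [W] is the set of these neighbours. *)
Lemma dominant_set (R : realType) (k T : nat) : (0 < k)%N -> (0 < T)%N ->
  exists N : nat, forall (n : nat) (G : graph n) (x : 'I_n -> R) (lam : R),
    (N <= n)%N -> degenerate G T -> bipartite_free G k T ->
    (forall i, 0 <= x i <= 1) -> (exists z, x z = 1) ->
    (forall i, \sum_j (adj G i j)%:R * x j = lam * x i) ->
    0 <= lam -> k%:R * (n%:R - k%:R) <= lam ^+ 2 ->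
    exists W : {set 'I_n}, [/\ #|W| = k,
      forall w, w \in W -> 1 / 2 <= x w,
      forall v, v \notin W -> 8 * T%:R * x v <= 1,
      (T <= #|common G W|)%N &
      forall v, v \notin W -> (#|nb G v :&: common G W| <= T)%N].
Proof.
move=> k0 T0.
have kp : 1 <= k%:R :> R by rewrite ler1n.
have Tp : 1 <= T%:R :> R by rewrite ler1n.
(* [eta2] is the bound wanted outside [W], [eps] the deficit from 1 allowed inside [W], [eta] the
   threshold for large entries; [a1] and [a2] are the cutoffs of [deg_large] for [eta] and
   [eta2]. *)
pose eta2 : R := (8 * T%:R)^-1.
pose eps : R := eta2 / (16 * T%:R * k%:R).
pose eta : R := eps / (8 * T%:R).
pose a1 : R := k%:R * eta / (16 * T%:R).
pose a2 : R := k%:R * eta2 / (16 * T%:R).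
have T8 : 0 < 8 * T%:R :> R by lra.
have eta2p : 0 < eta2 by rewrite invr_gt0.
have epsp : 0 < eps by rewrite divr_gt0 // mulr_gt0 //; lra.
have etap : 0 < eta by rewrite divr_gt0.
have e2E : 8 * T%:R * eta2 = 1 by rewrite mulfV // gt_eqF.
have epsE : 16 * T%:R * k%:R * eps = eta2.
  by rewrite /eps mulrC divfK // gt_eqF // mulr_gt0 //; lra.
have etaE : 8 * T%:R * eta = eps by rewrite /eta mulrC divfK // gt_eqF.
have a1E : 16 * T%:R * a1 = k%:R * eta.
  by rewrite /a1 mulrC divfK // gt_eqF //; lra.
have a2E : 16 * T%:R * a2 = k%:R * eta2.
  by rewrite /a2 mulrC divfK // gt_eqF //; lra.
clearbody a2 a1 eta eps eta2.
have eps_small : 16 * k%:R * eps <= eta2.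
  rewrite -epsE; have : 0 <= k%:R * eps by rewrite mulr_ge0 // ltW.
  by nra.
have eps_half : eps <= 1 / 2.
  have : eta2 <= 1 by nra.
  by have := epsp; nra.
(* [C] bounds the number of large entries and [D] the extra walks through exceptional vertices, both
   independently of [n]. [N1] and [N2] serve [deg_large]; [N3] makes [k^2 + D] at most [eps n / 2];
   [N4] makes [16 T^2] at most [eta2 n]. *)
have [C hC] := nat_above (8 * T%:R ^+ 2 / eta).
have [D hDE] : exists D : R, D = (C * (2 ^ C * T))%:R by eexists.
have D0 : 0 <= D by rewrite hDE.
have [N1 hN1] := nat_above (2 * (2 * T%:R / a1 ^+ 2) ^+ 2).
have [N2 hN2] := nat_above (2 * (2 * T%:R / a2 ^+ 2) ^+ 2).
have [N3 hN3] := nat_above (2 * (k%:R * k%:R + D) / eps).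
have [N4 hN4] := nat_above (16 * T%:R ^+ 2 / eta2).
exists (4 * k + N1 + N2 + N3 + N4 + 2 * T)%N.
move=> n G x lam hn dG bG x01 [z xz] xE lam0 lam2.
have hnat m : (m <= 4 * k + N1 + N2 + N3 + N4 + 2 * T)%N -> m%:R <= n%:R :> R.
  by move=> hm; rewrite ler_nat (leq_trans hm).
have n4k : 4 * k%:R <= n%:R :> R by rewrite -natrM hnat //; clear; lia.
have n1 : 2 * (2 * T%:R / a1 ^+ 2) ^+ 2 <= n%:R by apply: le_trans hN1 (hnat _ _); clear; lia.
have n2 : 2 * (2 * T%:R / a2 ^+ 2) ^+ 2 <= n%:R by apply: le_trans hN2 (hnat _ _); clear; lia.
have n3 : 2 * (k%:R * k%:R + D) <= eps * n%:R.
  rewrite [leRHS]mulrC -ler_pdivrMr //; apply: le_trans hN3 (hnat _ _); clear; lia.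
have n4 : 16 * T%:R ^+ 2 <= eta2 * n%:R.
  rewrite [leRHS]mulrC -ler_pdivrMr //; apply: le_trans hN4 (hnat _ _); clear; lia.
have n5 : 2 * T%:R <= n%:R :> R by rewrite -natrM hnat //; clear; lia.
have np : 0 < n%:R :> R by lra.
have n0 : (0 < n)%N by rewrite -(ltr0n R).
have x_le1 i : x i <= 1 by have /andP[] := x01 i.
pose L := [set w | eta <= x w].
have LnotE w : w \notin L -> x w <= eta by apply: large_notin.
have degL v : v \in L -> eta * n%:R <= 4 * T%:R * #|nb G v|%:R.
  by rewrite inE; apply: (deg_large k0 T0 dG x01 xE lam0 lam2 etap a1E n4k n1).
have cL : (#|L| <= C)%N.
  rewrite -(ler_nat R); apply: le_trans hC; rewrite ler_pdivlMr //.
  exact: (deg_card_large dG etap n0 degL).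
have hD : (#|L| * (2 ^ #|L| * T))%:R <= D.
  by rewrite hDE ler_nat leq_mul // leq_mul2r leq_exp2l // cL orbT.
have walks (K : R) v : 0 <= K ->
    (forall u, (#|nb G u :&: L| <= k)%N ->
       \sum_(w in L) (adj G u w)%:R * x w <= K) ->
    k%:R * (n%:R - k%:R) * x v <= K * #|nb G v|%:R + D + eps * n%:R / 4.
  move=> K0 hK; have := walks_typical dG bG x01 xE v (ltW etap) K0 LnotE hK.
  have -> : 2 * T%:R * n%:R * eta = eps * n%:R / 4 by rewrite -etaE; field.
  have : k%:R * (n%:R - k%:R) * x v <= lam ^+ 2 * x v.
    by apply: ler_wpM2r => //; have /andP[] := x01 v.
  by move: hD; lra.
(* [walks] with [K = k] bounds the degree from below; the error terms cost the second [eps]. *)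
have nearfull v : 1 - eps <= x v -> (1 - 2 * eps) * n%:R <= #|nb G v|%:R.
  move=> hv; have hw : forall u, (#|nb G u :&: L| <= k)%N ->
      \sum_(w in L) (adj G u w)%:R * x w <= k%:R.
    by move=> u hu; apply: (le_trans (weight_le G x01 L u)); rewrite ler_nat.
  have := walks k%:R v (ler0n R k) hw.
  have : k%:R * (n%:R - k%:R) * (1 - eps) <= k%:R * (n%:R - k%:R) * x v.
    by apply: ler_wpM2l => //; apply: mulr_ge0 => //; lra.
  move=> h1 h2; rewrite -(ler_pM2l (lt_le_trans ltr01 kp)).
  have : 0 <= k%:R * k%:R * eps by rewrite !mulr_ge0 // ltW.
  have : eps * n%:R <= k%:R * (eps * n%:R).
    by rewrite ler_peMl // mulr_ge0 ?ltW.
  have : 0 <= eps * n%:R by rewrite mulr_ge0 // ltW.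
  have kk0 : 0 <= k%:R * k%:R :> R by rewrite mulr_ge0.
  move: h1 h2 n3; move: (#|nb G v|%:R) => dv.
  by move=> *; nra.
(* Otherwise [walks] with [K = k - eps] applies at the vertex [z] of entry 1, and the loss of
   [eps n] exceeds the error terms, which total at most [3 eps n / 4]. *)
have [/existsP[u /andP[uk hu]]|/existsPn hno] := boolP [exists u,
    (#|nb G u :&: L| <= k)%N && (k%:R - eps <= \sum_(w in L) (adj G u w)%:R * x w)];
  last first.
  exfalso; have hw : forall u, (#|nb G u :&: L| <= k)%N ->
      \sum_(w in L) (adj G u w)%:R * x w <= k%:R - eps.
    by move=> u hu; have := hno u; rewrite hu /= -ltNge => /ltW.
  have k_eps : 0 <= k%:R - eps by lra.
  have := walks (k%:R - eps) z k_eps hw; rewrite xz.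
  have : (k%:R - eps) * #|nb G z|%:R <= (k%:R - eps) * n%:R.
    apply: ler_wpM2l => //; rewrite ler_nat -[leqRHS]card_ord.
    exact: max_card.
  have : 0 < eps * n%:R by rewrite mulr_gt0.
  have kk0 : 0 <= k%:R * k%:R :> R by rewrite mulr_ge0.
  by move: n3 => *; nra.
pose W := nb G u :&: L.
rewrite sum_adj -/W in hu; rewrite -/W in uk.
(* As entries are at most 1 and [eps] is at most 1/2, a total of [k - eps] needs all [k] entries,
   each at least [1 - eps]. *)
have cW : #|W| = k.
  apply/eqP; rewrite eqn_leq uk /= leqNgt; apply/negP => Wk.
  have : \sum_(w in W) x w <= #|W|%:R * 1 by apply: sum_le_card.
  have : #|W|%:R <= k%:R - 1 :> R.
    by rewrite lerBrDr natr1 ler_nat.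
  by lra.
have xW w : w \in W -> 1 - eps <= x w.
  move=> wW; move: hu; rewrite (big_setD1 w wW) /=.
  have : \sum_(i in W :\ w) x i <= #|W :\ w|%:R * 1 by apply: sum_le_card.
  have : #|W :\ w|%:R = k%:R - 1 :> R.
    by rewrite -cW (cardsD1 w W) wW natrD addrAC subrr add0r.
  by lra.
pose Rs := common G W.
have cR : #|~: Rs|%:R <= 2 * k%:R * eps * n%:R.
  apply: (@le_trans _ _ (\sum_(w in W) #|~: nb G w|%:R)).
    rewrite -natr_sum ler_nat.
    apply: (@leq_trans #|\bigcup_(w in W) ~: nb G w|).
      apply: subset_leq_card; apply/subsetP => v; rewrite !inE => /subsetPn[w wW].
      by rewrite inE => h; apply/bigcupP; exists w; rewrite // !inE adj_sym.
    elim/big_rec2: _ => [|w m S _ h]; first by rewrite cards0.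
    by rewrite (leq_trans (leq_card_setU _ _)) // leq_add2l.
  have -> : 2 * k%:R * eps * n%:R = #|W|%:R * (2 * eps * n%:R).
    by rewrite cW; ring.
  rewrite mulr_natl -sumr_const; apply: ler_sum => w wW.
  have := nearfull w (xW w wW).
  have -> : #|~: nb G w|%:R = n%:R - #|nb G w|%:R :> R.
    by apply/eqP; rewrite eq_sym subr_eq -natrD addnC cardsC card_ord.
  by lra.
(* Otherwise [v |: W] would have [T] common neighbours, against [bG]. *)
have nbR v : v \notin W -> (#|nb G v :&: Rs| < T)%N.
  move=> vW; apply: leq_ltn_trans (bG (v |: W) _); last by rewrite cardsU1 vW cW.
  apply: subset_leq_card; apply/subsetP => y; rewrite inE => /andP[yv yR].
  rewrite inE; apply/subsetP => w; rewrite in_setU1 => /orP[/eqP->|wW].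
    by move: yv; rewrite !inE adj_sym.
  by rewrite inE; apply: adj_common yR.
exists W; split => //.
- by move=> w /xW; lra.
(* A larger entry would force degree at least [eta2 n / (4 T)]; but [v] has fewer than [T]
   neighbours in [Rs], and [eps] was chosen so that the complement of [Rs] is too small for the
   rest. *)
- move=> v vW; rewrite leNgt; apply/negP => hv.
  have hx : eta2 <= x v.
    by rewrite -(ler_pM2l T8) e2E ltW.
  have := deg_large k0 T0 dG x01 xE lam0 lam2 eta2p a2E n4k n2 hx.
  have : #|nb G v|%:R <= T%:R + #|~: Rs|%:R :> R.
    rewrite -natrD ler_nat -(cardsID Rs (nb G v)) leq_add //.
      by apply: ltnW; apply: nbR.
    by apply: subset_leq_card; apply/subsetP => y; rewrite !inE => /andP[].
  move=> h1 h2.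
  have : 4 * T%:R * #|nb G v|%:R
      <= 4 * T%:R * T%:R + 4 * T%:R * (2 * k%:R * eps * n%:R).
    rewrite -mulrDr; apply: ler_wpM2l; first by rewrite mulr_ge0.
    by apply: (le_trans h1); rewrite lerD2l.
  have -> : 4 * T%:R * (2 * k%:R * eps * n%:R) = eta2 * n%:R / 2.
    by rewrite -epsE; field.
  have : 0 < eta2 * n%:R by rewrite mulr_gt0.
  by have := n4; nra.
- rewrite -(ler_nat R) -/Rs.
  have : #|~: Rs|%:R = n%:R - #|Rs|%:R :> R.
    by apply/eqP; rewrite eq_sym subr_eq -natrD addnC cardsC card_ord.
  have h8 : eta2 <= 1 by nra.
  have : 16 * (k%:R * eps * n%:R) <= n%:R.
    have : 16 * k%:R * eps * n%:R <= 1 * n%:R.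
      by apply: ler_wpM2r; [rewrite ltW|apply: (le_trans eps_small)].
    by lra.
  by move: cR; nra.
by move=> v /nbR /ltnW.
Qed.

(** * Graphs with a dominating vertex *)

Section Dominating.
Variables (R : realType) (n : nat).
Implicit Types (G H : graph n) (x : 'I_n -> R).

Lemma rho_ge0 G : (0 < n)%N -> 0 <= rho R G.
Proof.
move=> n0; have [x [x01 [z xz] xE]] := perron R G n0.
rewrite -[rho R G]mulr1 -xz -xE; apply: sumr_ge0 => j _.
by rewrite mulr_ge0 //; have /andP[] := x01 j.
Qed.

Lemma eigenfun_ge_nb G x u v : (forall i, 0 <= x i) -> eigenfun G x ->
  adj G u v -> x v <= rho R G * x u.
Proof.
move=> x0 xE uv; rewrite -xE (bigD1 v) //= uv mul1r lerDl.
by apply: sumr_ge0 => j _; rewrite mulr_ge0.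
Qed.

(** Positivity passes along edges, from [z] to [w] and from [w] to every vertex. *)
Lemma eigenfun_gt0 G x w : (forall i, 0 <= x i) -> (exists z, 0 < x z) ->
  eigenfun G x -> (forall v, v != w -> adj G w v) -> forall v, 0 < x v.
Proof.
move=> x0 [z zp] xE hw.
have step u v : adj G u v -> 0 < x v -> 0 < x u.
  move=> uv vp; rewrite lt_def x0 andbT; apply: contraTneq vp => xu.
  by rewrite -leNgt (le_trans (eigenfun_ge_nb x0 xE uv)) // xu mulr0.
have wp : 0 < x w.
  have [<-//|zw] := eqVneq z w; exact: (step _ _ (hw _ zw)).
move=> v; have [->//|vw] := eqVneq v w.
by apply: (step _ w); rewrite // adj_sym hw.
Qed.

(** The dominating [w] makes the Perron vector of [G] positive, so as a test vector for [H] it gains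
    strictly on the edge [u v]. *)
Lemma rho_lt G H w u v : (forall i j, adj G i j -> adj H i j) ->
  (forall i, i != w -> adj G w i) -> adj H u v -> ~~ adj G u v ->
  rho R G < rho R H.
Proof.
move=> sGH hw uvH uvG.
have n0 : (0 < n)%N by apply: leq_trans (ltn_ord w).
have [x [x01 [z xz] xE]] := perron R G n0.
have x0 i : 0 <= x i by have /andP[] := x01 i.
have xp : forall i, 0 < x i.
  by apply: eigenfun_gt0 xE hw => //; exists z; rewrite xz.
have x2 : 0 < \sum_i x i ^+ 2.
  rewrite (bigD1 z) //= xz expr1n ltr_pwDl // sumr_ge0 // => j _.
  by rewrite sqr_ge0.
rewrite -(ltr_pM2r x2) -(qform_eigenfun xE).
apply: lt_le_trans (rayleigh H x n0).
have h i j : (adj G i j)%:R * x i * x j <= (adj H i j)%:R * x i * x j.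
  rewrite -!mulrA ler_wpM2r ?mulr_ge0 // ler_nat.
  by case e: (adj G i j) => //; rewrite (sGH _ _ e).
rewrite /qform (bigD1 u) //= [ltRHS](bigD1 u) //=; apply: ltr_leD.
  rewrite (bigD1 v) //= [ltRHS](bigD1 v) //=; apply: ltr_leD.
    by rewrite uvH (negbTE uvG) mul1r !mul0r mulr_gt0.
  by apply: ler_sum => j _.
by apply: ler_sum => i _; apply: ler_sum => j _.
Qed.

Lemma card_ord_lt k : (k <= n)%N -> #|[set i : 'I_n | (i < k)%N]| = k.
Proof.
move=> kn; rewrite -sum1_card (eq_bigl (fun i : 'I_n => (i < k)%N)).
  by rewrite (big_ord_narrow_cond (P := predT)) sum1_card card_ord.
by move=> i; rewrite inE.
Qed.

(** Let [s] be the sum of the Perron entries on the clique. Off the clique [r * x v = s]; on it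
    [r * x i] is at least the sum of the entries off the clique. Eliminating that sum gives
    [k (n - k) s <= r^2 s] with [s > 0]. *)
Lemma rho_Sgraph_ge k : (0 < k < n)%N ->
  k%:R * (n%:R - k%:R) <= rho R (Sgraph n k 0) ^+ 2.
Proof.
move=> /andP[k0 kn]; have n0 : (0 < n)%N by apply: leq_trans kn.
set S := Sgraph n k 0; set r := rho R S.
have [x [x01 [z xz] xE]] := perron R S n0.
have x0 i : 0 <= x i by have /andP[] := x01 i.
have xp : forall i, 0 < x i.
  apply: (@eigenfun_gt0 S x (Ordinal n0)) => //; first by exists z; rewrite xz.
  by move=> v hv; rewrite /= /Sadj eq_sym hv /= k0.
pose K := [set i : 'I_n | (i < k)%N].
have cK : #|K| = k by apply: card_ord_lt; apply: ltnW.
pose s := \sum_(i in K) x i.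
have sp : 0 < s.
  rewrite /s (bigD1 (Ordinal n0)) ?inE //= ltr_pwDl //.
  by apply: sumr_ge0.
have out v : v \notin K -> r * x v = s.
  rewrite inE -leqNgt => kv; rewrite -xE /s [RHS]big_mkcond.
  apply: eq_bigr => i _; rewrite inE /= /Sadj ltnNge kv /= ltn0 andbF orbF.
  case: ltnP => ik; rewrite ?andbF ?mul0r // andbT.
  by rewrite -val_eqE /= gtn_eqF ?mul1r // (leq_trans ik).
have inn i : i \in K -> \sum_(v in ~: K) x v <= r * x i.
  rewrite inE => ik; rewrite -xE big_mkcond; apply: ler_sum => v _.
  rewrite !inE /= /Sadj ik /= andbT -leqNgt; case: leqP => // kv.
    by rewrite -val_eqE /= ltn_eqF ?mul1r // (leq_trans ik).
  by rewrite mulr_ge0.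
have r0 : 0 <= r by apply: rho_ge0.
have h1 : k%:R * \sum_(v in ~: K) x v <= r * s.
  rewrite -cK mulr_natl -sumr_const /s big_distrr /=.
  by apply: ler_sum => i; apply: inn.
have h2 : r * \sum_(v in ~: K) x v = (n%:R - k%:R) * s.
  rewrite big_distrr /= (eq_bigr (fun=> s)) => [|v]; last by rewrite inE; apply: out.
  rewrite sumr_const -[LHS]mulr_natl; congr (_ * _).
  by apply/eqP; rewrite eq_sym subr_eq -natrD -[in X in (_ + X)%N]cK addnC cardsC card_ord.
rewrite -(ler_pM2r sp) -mulrA -h2 mulrCA expr2 -mulrA.
exact: ler_wpM2l.
Qed.

End Dominating.

(** * Comparing [G] with the join over [W] *)

Section Join.
Variables (n : nat) (G : graph n) (W : {set 'I_n}).
Local Notation C := (common G W).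

(* [K_W] joined to the graph induced by [G] on the common neighbourhood of [W],
   all remaining vertices being isolated outside [W]. *)
Definition join_adj (u v : 'I_n) : bool :=
  (u != v) && [|| u \in W, v \in W | [&& u \in C, v \in C & adj G u v]].

Lemma join_sym : symmetric join_adj.
Proof.
move=> u v; rewrite /join_adj eq_sym adj_sym; congr (_ && _).
by rewrite orbCA; congr [|| _, _ | _]; rewrite andbCA.
Qed.

Lemma join_irr : irreflexive join_adj.
Proof. by move=> u; rewrite /join_adj eqxx. Qed.

Definition join : graph n := Graph join_sym join_irr.

Variables (R : realType) (T : nat) (x : 'I_n -> R).
Hypothesis T_gt0 : (0 < T)%N.
Hypothesis dG : degenerate G T.
Hypothesis x01 : forall i, 0 <= x i <= 1.
Hypothesis xE : eigenfun G x.
Hypothesis W0 : W != set0.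
Hypothesis xW : forall w, w \in W -> 1 / 2 <= x w.
Hypothesis xnW : forall v, v \notin W -> 8 * T%:R * x v <= 1.
Hypothesis nbC : forall v, v \notin W -> (#|nb G v :&: C| <= T)%N.
Hypothesis hrho : rho R join <= rho R G.

Let x_ge0 i : 0 <= x i. Proof. by have /andP[] := x01 i. Qed.

Local Notation E := (~: (W :|: C)).

Let ex_notin u : u \in E -> u \notin W.
Proof. by rewrite !inE negb_or => /andP[]. Qed.

(** Relative to the sum of [x] over [E], the new edges to [W] gain at least 1, counted in both
    orders, while the lost edges into [C] and inside [E] cost at most 1/4 each; 1/2 remains. *)
Lemma qform_join_ge : qform G x + (\sum_(e in E) x e) / 2 <= qform join x.
Proof.
have Tp : 1 <= T%:R :> R by rewrite ler1n.
have T8 : 0 < 8 * T%:R :> R by lra.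
(* [p] records the pairs gained between [E] and [W], [q] those lost between [E] and [C], [s] those
   lost inside [E]. *)
pose p u v : R := (u \in E)%:R * ((v \in W)%:R * ((1 - (adj G u v)%:R) * (x u * x v))).
pose q u v : R := (u \in E)%:R * ((v \in C)%:R * ((adj G u v)%:R * (x u * x v))).
pose s u v : R := (u \in E)%:R * ((v \in E)%:R * ((adj G u v)%:R * (x u * x v))).
have pt u v : (adj G u v)%:R * x u * x v + p u v + p v u - q u v - q v u - s u v
    <= (adj join u v)%:R * x u * x v.
  have xx : 0 <= x u * x v by rewrite mulr_ge0.
  rewrite -!mulrA /p /q /s [x v * x u]mulrC [adj G v u]adj_sym /= /join_adj.
  have hE a : (a \in E) = (a \notin W) && (a \notin C) by rewrite !inE negb_or.
  have hC a : a \in W -> (a \in C) = false.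
    by move=> aW; apply: contraTF aW => /common_notin.
  have hWC a b : a \in W -> b \in C -> adj G b a.
    by move=> aW; apply: adj_common.
  have [<-|uv] := eqVneq u v.
    rewrite adj_irr hE /=.
    by case uW: (u \in W); case uC: (u \in C); rewrite /= ?mulr1n ?mulr0n; lra.
  rewrite !hE; case uW: (u \in W).
    rewrite (hC _ uW) /=; case vW: (v \in W).
      by case: (adj G u v); rewrite /= ?mulr1n ?mulr0n; lra.
    case vC: (v \in C).
      by rewrite [adj G u v]adj_sym (hWC _ _ uW vC) /= ?mulr1n ?mulr0n; lra.
    by case: (adj G u v); rewrite /= ?mulr1n ?mulr0n; lra.
  case vW: (v \in W).
    rewrite (hC _ vW); case uC: (u \in C).
      by rewrite (hWC _ _ vW uC) /= ?mulr1n ?mulr0n; lra.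
    by case: (adj G u v); rewrite /= ?mulr1n ?mulr0n; lra.
  by case: (u \in C); case: (v \in C); case: (adj G u v);
    rewrite /= ?mulr1n ?mulr0n; lra.
have sumE (f : 'I_n -> R) : \sum_u (u \in E)%:R * f u = \sum_(u in E) f u.
  by rewrite [RHS]big_mkcond; apply: eq_bigr => u _; case: (u \in E); rewrite ?mul1r ?mul0r.
have hp : (\sum_(e in E) x e) / 2 <= \sum_u \sum_v p u v.
  rewrite big_distrl /= [leRHS](eq_bigr (fun u => (u \in E)%:R *
     \sum_v (v \in W)%:R * ((1 - (adj G u v)%:R) * (x u * x v)))); last first.
    by move=> u _; rewrite -big_distrr.
  rewrite sumE; apply: ler_sum => u uE.
  have /subsetPn[w wW wu] : ~~ (W \subset nb G u).
    by move: uE; rewrite !inE negb_or => /andP[].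
  have uw : adj G u w = false by move: wu; rewrite inE => /negbTE.
  rewrite (bigD1 w) //= wW uw subr0 !mul1r.
  have := ler_wpM2l (x_ge0 u) (xW wW).
  suff : 0 <= \sum_(i < n | i != w)
      (i \in W)%:R * ((1 - (adj G u i)%:R) * (x u * x i)) by lra.
  apply: sumr_ge0 => i _; rewrite !mulr_ge0 //.
  by case: (adj G u i); rewrite /= ?mulr1n ?mulr0n; lra.
have hq : \sum_u \sum_v q u v <= (\sum_(e in E) x e) / 8.
  rewrite big_distrl /= [leLHS](eq_bigr (fun u => (u \in E)%:R *
     \sum_v (v \in C)%:R * ((adj G u v)%:R * (x u * x v)))); last first.
    by move=> u _; rewrite -big_distrr.
  rewrite sumE; apply: ler_sum => u uE.
  have -> : \sum_v (v \in C)%:R * ((adj G u v)%:R * (x u * x v))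
     = x u * \sum_(v in nb G u :&: C) x v.
    rewrite -sum_adj big_distrr /= [RHS]big_mkcond; apply: eq_bigr => v _.
    by case: (v \in C); rewrite ?mul0r // mul1r mulrCA.
  apply: ler_wpM2l => //; rewrite -(ler_pM2l T8).
  apply: (@le_trans _ _ (#|nb G u :&: C|%:R * 1)).
    rewrite big_distrr /=; apply: sum_le_card => v; rewrite inE => /andP[_].
    by move=> /common_notin; apply: xnW.
  have : #|nb G u :&: C|%:R <= T%:R :> R by rewrite ler_nat nbC // ex_notin.
  by lra.
have hs : \sum_u \sum_v s u v <= (\sum_(e in E) x e) / 4.
  have c0 : 0 <= (8 * T%:R)^-1 :> R by rewrite invr_ge0 ltW.
  have hy v : v \in E -> 0 <= x v <= (8 * T%:R)^-1.
    move=> vE; rewrite x_ge0 /= -(ler_pM2l T8) mulfV ?gt_eqF //.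
    by apply: xnW; apply: ex_notin.
  have := degenerate_sum dG c0 hy.
  have -> : 2 * T%:R * (8 * T%:R)^-1 = 1 / 4 :> R.
    by field; rewrite gt_eqF //; lra.
  rewrite mulrC mul1r; apply: le_trans; rewrite [leRHS]big_mkcond.
  apply: ler_sum => u _; rewrite /s -big_distrr /=.
  case: (u \in E); last by rewrite mul0r.
  rewrite mul1r [leRHS]big_mkcond; apply: ler_sum => v _.
  by case: (v \in E); rewrite ?mul0r // mul1r mulrA.
have : \sum_u \sum_v ((adj G u v)%:R * x u * x v + p u v + p v u - q u v - q v u - s u v)
    <= qform join x.
  by apply: ler_sum => u _; apply: ler_sum => v _; apply: pt.
have hsw (f : 'I_n -> 'I_n -> R) : \sum_u \sum_v f v u = \sum_u \sum_v f u v.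
  exact: exchange_big.
under eq_bigr do rewrite !(big_split, sumrN) /=.
rewrite !(big_split, sumrN) /= (hsw p) (hsw q) -/(qform G x).
by move: hp hq hs; lra.
Qed.

(** The assumption on [rho] leaves no slack in [qform_join_ge]: [x] sums to 0 over [E] and is also
    an eigenvector of the join, where a vertex of [W] dominates. So [x] is positive, [E] is empty
    and [G] lies in the join; a missing edge would raise the form strictly. *)
Lemma join_eq : forall u v, adj G u v = adj join u v.
Proof.
have [w wW] := set0Pn _ W0.
have n0 : (0 < n)%N by apply: leq_trans (ltn_ord w).
have s2 : 0 <= \sum_i x i ^+ 2 by apply: sumr_ge0 => i _; apply: sqr_ge0.
have Ege : 0 <= \sum_(e in E) x e by apply: sumr_ge0.
have hge := qform_join_ge.
have hr : rho R join * (\sum_i x i ^+ 2) <= qform G x.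
  by rewrite (qform_eigenfun xE) ler_wpM2r.
have hJ := rayleigh join x n0.
have E0 : \sum_(e in E) x e = 0 by lra.
have qE : qform join x = qform G x by lra.
have xJ : eigenfun join x by apply: rayleigh_eigenfun => //; rewrite qE.
have xp : forall v, 0 < x v.
  apply: (@eigenfun_gt0 _ _ join x w) => //.
    by exists w; have := xW wW; lra.
  by move=> v vw; rewrite /= /join_adj eq_sym vw wW.
have cover v : (v \in W) || (v \in C).
  apply: contraT => hv; have vE : v \in E by rewrite in_setC in_setU.
  have := xp v; rewrite (psumr_eq0P _ E0) ?ltxx //.
have sub u v : adj G u v -> adj join u v.
  move=> uv; rewrite /= /join_adj uv andbT; apply/andP; split.
    by apply: contraTneq uv => ->; rewrite adj_irr.
  by have := cover u; have := cover v; case: (u \in W); case: (v \in W) => //= -> ->.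
move=> u v; case uvG: (adj G u v); first by rewrite sub.
apply/esym/negP => uvJ.
have : qform G x < qform join x; last by rewrite qE ltxx.
have h i j : (adj G i j)%:R * x i * x j <= (adj join i j)%:R * x i * x j.
  rewrite -!mulrA ler_wpM2r ?mulr_ge0 // ler_nat.
  by case e: (adj G i j) => //; rewrite (sub _ _ e).
rewrite /qform (bigD1 u) //= [ltRHS](bigD1 u) //=; apply: ltr_leD.
  rewrite (bigD1 v) //= [ltRHS](bigD1 v) //=; apply: ltr_leD.
    by rewrite uvG; move: uvJ => /= ->; rewrite mul1r !mul0r mulr_gt0.
  by apply: ler_sum => j _; apply: h.
by apply: ler_sum => i _; apply: ler_sum => j _; apply: h.
Qed.

End Join.

(** * Embedding across a complete bipartite pair *)

Lemma extend_inj (aT rT : finType) (P Y : {set aT}) (C : {set rT}) (g : aT -> rT) :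
  {in P &, injective g} -> (forall x, x \in P -> g x \in C) ->
  (#|P :|: Y| <= #|C|)%N ->
  exists f : aT -> rT, [/\ {in P, f =1 g}, {in P :|: Y &, injective f} &
    forall x, x \in P :|: Y -> f x \in C].
Proof.
move=> gI gC; have [m] := ubnP #|Y :\: P|; elim: m Y => // m IH Y hm hc.
have [Y0|[y]] := set_0Vmem (Y :\: P).
  have -> : P :|: Y = P by apply/setUidPl; rewrite -setD_eq0 Y0.
  by exists g.
rewrite inE => /andP[yP yY].
have PYE : P :|: Y = y |: (P :|: Y :\ y) by rewrite setUCA setD1K.
have yn : y \notin P :|: Y :\ y by rewrite !inE eqxx (negbTE yP).
have hc' : (#|P :|: Y :\ y| < #|C|)%N by move: hc; rewrite PYE cardsU1 yn.
have hm' : (#|Y :\ y :\: P| < m)%N.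
  move: hm; rewrite ltnS; apply: leq_trans; apply: proper_card; apply/properP.
  split; first by apply: setSD; rewrite subD1set.
  by exists y; rewrite !inE ?yP ?yY ?eqxx.
have [f [fg fI fC]] := IH _ hm' (ltnW hc').
have [c cC cf] : exists2 c, c \in C & c \notin f @: (P :|: Y :\ y).
  apply/subsetPn; apply: contraL hc' => /subset_leq_card h.
  by rewrite -leqNgt (leq_trans h) // leq_imset_card.
exists (fun z => if z == y then c else f z); split.
- by move=> z zP; case: eqP => [zy|_]; [rewrite -zy zP in yP|apply: fg].
- rewrite PYE => a b; rewrite !in_setU1; case: (eqVneq a y) => [->|ay] /= ha;
    case: (eqVneq b y) => [->|bY] //= hb.
  + by move=> cE; move/negP: cf; case; rewrite cE imset_f.
  + by move=> cE; move/negP: cf; case; rewrite -cE imset_f.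
  by apply: fI.
rewrite PYE => a; rewrite in_setU1; case: eqVneq => //= _; exact: fC.
Qed.

(** [A] goes to [W] and the rest to [C], so edges meeting [A] come for free. Only the edges avoiding
    [A], with both ends in [P], must be realised by [g] inside [C]. *)
Lemma contains_bipartite (t n : nat) (F : graph t) (G : graph n)
    (A P : {set 'I_t}) (W C : {set 'I_n}) (g : 'I_t -> 'I_n) :
  (forall w v, w \in W -> v \in C -> adj G v w) ->
  (#|A| <= #|W|)%N -> (t <= #|C|)%N ->
  (forall x y, x \in A -> y \in A -> ~~ adj F x y) ->
  P \subset ~: A -> {in P &, injective g} -> (forall x, x \in P -> g x \in C) ->
  (forall x y, adj F x y -> x \notin A -> y \notin A ->
     [/\ x \in P, y \in P & adj G (g x) (g y)]) ->
  contains G F.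
Proof.
move=> WC AW tC Aind PA gI gC hP.
have [||/=|f1 [_ f1I f1W]] := @extend_inj _ _ set0 A W g.
- by move=> x y; rewrite inE.
- by move=> x; rewrite inE.
- by rewrite set0U.
rewrite set0U in f1I f1W.
have [//|//|/=|f2 [f2g f2I f2C]] := @extend_inj _ _ P (~: A) C g.
  by apply: leq_trans tC; rewrite -[leqRHS]card_ord max_card.
rewrite (setUidPr PA) in f2I f2C.
have nA x : x \notin A -> x \in ~: A by rewrite inE.
exists (fun x => if x \in A then f1 x else f2 x).
  move=> x y; case: ifPn => xA; case: ifPn => yA; first exact: f1I.
  - move=> e; have := WC _ _ (f1W _ xA) (f2C _ (nA _ yA)).
    by rewrite e adj_irr.
  - move=> e; have := WC _ _ (f1W _ yA) (f2C _ (nA _ xA)).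
    by rewrite e adj_irr.
  by apply: f2I; apply: nA.
move=> x y xy; case: ifPn => xA; case: ifPn => yA.
- by have := Aind _ _ xA yA; rewrite xy.
- by rewrite adj_sym; apply: WC; [apply: f1W|apply/f2C/nA].
- by apply: WC; [apply: f1W|apply/f2C/nA].
by have [xP yP h] := hP _ _ xy xA yA; rewrite !f2g.
Qed.

(** * Building a tree leaf by leaf *)

Section Trees.
Variables (t : nat) (F : graph t).

(* [built r S]: the vertex set [S] is obtained from [{r}] by attaching leaves. *)
Inductive built (r : 'I_t) : {set 'I_t} -> Prop :=
| Built1 : built r [set r]
| BuiltS S x y of built r S & x \in S & y \notin S & adj F x y &
    (forall z, z \in S -> adj F z y -> z = x) : built r (y |: S).

Lemma path_crossing (T : eqType) (e : rel T) (S : pred T) x p :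
  path e x p -> S x -> ~~ S (last x p) -> exists a b, [/\ S a, ~~ S b & e a b].
Proof.
elim: p x => [|y p IH] x /=; first by move=> _ ->.
move=> /andP[xy hp] Sx hl; case Sy: (S y); first exact: (IH y).
by exists x, y; rewrite Sx Sy xy.
Qed.

Lemma built_root r S : built r S -> r \in S.
Proof. by elim => [|S' x y _ h _ _ _ _]; rewrite ?inE ?eqxx // h orbT. Qed.

Definition inner (S : {set 'I_t}) : rel 'I_t :=
  fun a b => [&& a \in S, b \in S & adj F a b].

Lemma inner_sym S : connect_sym (inner S).
Proof.
by apply: sym_connect_sym => a b; rewrite /inner andbCA adj_sym.
Qed.

Lemma built_connect r S : built r S -> {in S, forall x, connect (inner S) r x}.
Proof.
elim => [|S' x y hS IH xS yS xy _] z; first by rewrite inE => /eqP ->.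
have sub : subrel (connect (inner S')) (connect (inner (y |: S'))).
  apply: connect_sub => a b /= /and3P[aS bS ab]; apply: connect1.
  by rewrite /inner !in_setU1 aS bS ab !orbT.
rewrite in_setU1 => /orP[/eqP ->|zS]; last exact/sub/IH.
apply: connect_trans (sub _ _ (IH _ xS)) _; apply: connect1.
by rewrite /inner !in_setU1 eqxx xS xy orbT.
Qed.

(** While [S] is not everything, connectivity gives an edge [x y] leaving it; a second neighbour of
    [y] in [S] would close a cycle, as [S] is itself connected. *)
Lemma tree_built r : tree F -> built r setT.
Proof.
move=> [[_ conn] acyc].
suff : forall m S, built r S -> (#|~: S| <= m)%N -> built r setT.
  by move/(_ _ _ (Built1 r) (leqnn _)).
elim=> [|m IH] S hS hm.
  suff <- : S = setT by [].
  by apply/eqP; rewrite -[S]setCK -setC0; apply/eqP; congr (~: _);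
    apply/eqP; rewrite -cards_eq0 -leqn0.
have [S0|[y0]] := set_0Vmem (~: S).
  by suff <- : S = setT by []; rewrite -[S]setCK S0 setC0.
rewrite inE => y0S; have /connectP[p hp lp] := conn r y0.
rewrite lp in y0S.
have [x [y [/= xS yS xy]]] := path_crossing hp (built_root hS) y0S.
apply: (IH (y |: S)); last first.
  move: hm; rewrite (cardsD1 y (~: S)) inE yS add1n ltnS.
  by have -> : ~: (y |: S) = (~: S) :\ y by rewrite setCU setIC -setDE.
apply: (BuiltS hS xS yS xy) => z zS zy; apply/eqP; apply: contraT => zx.
have : connect (inner S) x z.
  apply: connect_trans (built_connect hS zS).
  by rewrite inner_sym; apply: built_connect.
move=> /connectP[q0 hq0 zE].
case: (shortenP hq0) zE => q hq uq _ zE.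
have qS : {subset x :: q <= S}.
  move=> a; rewrite inE => /orP[/eqP-> //|]; elim: q x hq {uq zE hq0 xS xy zx} => //= b q IHq c.
  by case/andP=> /and3P[_ bS _] hq; rewrite inE => /orP[/eqP->|/(IHq _ hq)].
have hq' : path (adj F) x q by apply: sub_path hq => a b /= /and3P[].
(* Acyclicity leaves fewer than three vertices here, so [q] is empty and [z] equals [x], against
   [zx]. *)
have cyc : ucycle (adj F) (y :: x :: q).
  rewrite /ucycle /= rcons_path adj_sym xy hq' -zE zy /=.
  by move: (uq) => /= ->; rewrite andbT; apply: contra yS => /qS.
have := acyc _ cyc; case: q zE {hq uq qS hq' cyc} => //= zE.
by rewrite zE eqxx in zx.
Qed.

(** Greedy embedding: when a leaf is attached, fewer than [t] vertices are occupied, so the image of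
    its parent still has a free neighbour in [S]. *)
Lemma tree_contains n (G : graph n) (S : {set 'I_n}) : tree F -> S != set0 ->
  (forall v, v \in S -> (t <= #|nb G v :&: S|)%N) -> contains G F.
Proof.
move=> hT /set0Pn[s sS] hS; have [[t0 _] _] := hT.
pose r := Ordinal t0.
suff : forall Q, built r Q -> exists f : 'I_t -> 'I_n, [/\ {in Q &, injective f},
    (forall x, x \in Q -> f x \in S) &
    (forall x y, x \in Q -> y \in Q -> adj F x y -> adj G (f x) (f y))].
  move/(_ _ (tree_built r hT)) => [f [fI _ fA]].
  by exists f => [x y|x y]; [apply: fI|apply: fA]; rewrite in_setT.
move=> Q; elim => [|Q' x y hQ [f [fI fS fA]] xQ yQ xy uniqx].
  exists (fun=> s); split => //.
    by move=> a b; rewrite !inE => /eqP-> /eqP->.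
  by move=> a b; rewrite !inE => /eqP-> /eqP->; rewrite adj_irr.
have [c] : exists c, c \in (nb G (f x) :&: S) :\: f @: Q'.
  apply/set0Pn; rewrite setD_eq0; apply/negP => /subset_leq_card h.
  have := leq_trans (leq_trans (hS _ (fS _ xQ)) h) (leq_imset_card _ _).
  rewrite leqNgt => /negP; apply.
  rewrite -[X in (_ < X)%N]card_ord; apply: proper_card; apply/properP.
  by split; [apply/subsetP|exists y].
rewrite in_setD in_setI inE => /andP[cf /andP[xc cS]].
have hf z : z \in Q' -> (if z == y then c else f z) = f z.
  by move=> zQ; case: eqP => // zy; rewrite -zy zQ in yQ.
exists (fun z => if z == y then c else f z); split.
- move=> a b; rewrite !in_setU1 => /orP[/eqP->|aQ] /orP[/eqP->|bQ] //.
  + by rewrite eqxx hf // => cE; rewrite cE imset_f in cf.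
  + by rewrite eqxx hf // => cE; rewrite -cE imset_f in cf.
  by rewrite !hf //; apply: fI.
- by move=> a; rewrite in_setU1 => /orP[/eqP->|aQ]; rewrite ?eqxx // hf ?fS.
move=> a b; rewrite !in_setU1 => /orP[/eqP->|aQ] /orP[/eqP->|bQ] //.
- by rewrite adj_irr.
- by rewrite adj_sym => /(uniqx _ bQ) ->; rewrite eqxx hf // adj_sym.
- by move=> /(uniqx _ aQ) ->; rewrite eqxx hf.
by rewrite !hf //; apply: fA.
Qed.

Lemma free_degenerate n (G : graph n) : tree F -> graph_free F G -> degenerate G t.
Proof.
move=> hT hF S S0; apply/exists_inP; apply: contraT => /exists_inPn h.
by case: hF; apply: (tree_contains hT S0) => v /h; rewrite -ltnNge => /ltnW.
Qed.

(** [h] is the depth below the root, assigned leaf by leaf along [built]; the third clause is the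
    uniqueness of the parent. *)
Lemma tree_height r : tree F -> exists h : 'I_t -> nat, [/\ h r = 0%N,
  (forall x y, adj F x y -> h x = (h y).+1 \/ h y = (h x).+1),
  (forall v x y, adj F v x -> adj F v y -> (h x < h v)%N -> (h y < h v)%N -> x = y) &
  (forall v, walk F (h v) v r)].
Proof.
move=> hT.
suff : forall Q, built r Q -> exists h : 'I_t -> nat, [/\ h r = 0%N,
    {in Q &, forall x y, adj F x y -> h x = (h y).+1 \/ h y = (h x).+1},
    {in Q & &, forall v x y, adj F v x -> adj F v y ->
       (h x < h v)%N -> (h y < h v)%N -> x = y} &
    {in Q, forall v, walk F (h v) v r}].
  move/(_ _ (tree_built r hT)) => [h [hr h1 h2 h3]].
  by exists h; split => // [x y|v x y|v]; [apply: h1|apply: h2|apply: h3].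
move=> Q; elim => [|Q' x y hQ [h [hr h1 h2 h3]] xQ yQ xy uniqx].
  exists (fun=> 0%N); split => //.
  - by move=> a b; rewrite !inE => /eqP-> /eqP->; rewrite adj_irr.
  - move=> v; rewrite inE => /eqP ->; apply/existsP; exists [tuple] => /=.
    by rewrite eqxx.
pose h' z := if z == y then (h x).+1 else h z.
have hy : h' y = (h x).+1 by rewrite /h' eqxx.
have hf z : z \in Q' -> h' z = h z.
  by rewrite /h' => zQ; case: eqP => // zy; rewrite -zy zQ in yQ.
exists h'; split.
- by rewrite hf // (built_root hQ).
- move=> a b; rewrite !in_setU1 => /orP[/eqP->|aQ] /orP[/eqP->|bQ] //.
  + by rewrite adj_irr.
  + by rewrite adj_sym => /(uniqx _ bQ) ->; rewrite hy hf //; left.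
  + by move=> /(uniqx _ aQ) ->; rewrite hy hf //; right.
  by rewrite !hf //; apply: h1.
- move=> v a b; rewrite !in_setU1 => /orP[/eqP->|vQ].
    move=> /orP[/eqP->|aQ]; first by rewrite adj_irr.
    move=> /orP[/eqP->|bQ]; first by rewrite [adj F y y]adj_irr.
    by rewrite ![adj F y _]adj_sym => /(uniqx _ aQ) -> /(uniqx _ bQ) ->.
  move=> /orP[/eqP->|aQ].
    move=> _ /(uniqx _ vQ) ->; rewrite hy hf // => _; lia.
  move=> /orP[/eqP->|bQ].
    move=> _ /(uniqx _ vQ) ->; rewrite hy [h' x]hf // => _; lia.
  by rewrite !hf //; apply: h2.
move=> v; rewrite in_setU1 => /orP[/eqP->|vQ]; last by rewrite hf // h3.
rewrite hy; have /existsP[p /andP[hp lp]] := h3 x xQ.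
by apply/existsP; exists [tuple of x :: p]; rewrite /= adj_sym xy hp.
Qed.

End Trees.

(** * Walks, distances and diametral leaves *)

Lemma iota_find_le (P : pred nat) m k : P k -> (find P (iota 0 m) <= k)%N.
Proof.
move=> Pk; rewrite leqNgt; apply/negP => h.
have km : (k < m)%N.
  by apply: leq_trans h _; rewrite -[leqRHS](size_iota 0) find_size.
by have := before_find 0%N h; rewrite nth_iota // add0n Pk.
Qed.

Section Distances.
Variables (t : nat) (F : graph t).

Lemma walkP k x y :
  reflect (exists p, [/\ size p = k, path (adj F) x p & last x p = y]) (walk F k x y).
Proof.
apply: (iffP existsP) => [[p /andP[hp /eqP lp]]|[p [sp hp lp]]].
  by exists p; rewrite size_tuple.
by move/eqP: sp => sp; exists (Tuple sp); rewrite /= hp lp eqxx.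
Qed.

Lemma walk0 x : walk F 0 x x.
Proof. by apply/walkP; exists [::]. Qed.

Lemma walk_cons k x y z : adj F x y -> walk F k y z -> walk F k.+1 x z.
Proof.
move=> xy /walkP[p [sp hp lp]]; apply/walkP; exists (y :: p).
by rewrite /= sp xy.
Qed.

Lemma walk_cat k m x y z : walk F k x y -> walk F m y z -> walk F (k + m) x z.
Proof.
move=> /walkP[p [sp hp lp]] /walkP[q [sq hq lq]]; apply/walkP; exists (p ++ q).
by rewrite size_cat sp sq cat_path hp last_cat lp.
Qed.

Lemma walk_sym k x y : walk F k x y -> walk F k y x.
Proof.
move=> /walkP[p [sp hp lp]]; apply/walkP; exists (rev (belast x p)).
rewrite size_rev size_belast sp -lp rev_path; split => //.
  by apply: sub_path hp => a b; rewrite adj_sym.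
by case: p {sp hp lp} => //= a p; rewrite rev_cons last_rcons.
Qed.

Lemma gdist_le k x y : walk F k x y -> (gdist F x y <= k)%N.
Proof. exact: (@iota_find_le (fun k => walk F k x y)). Qed.

(** A path without repetition has fewer than [t] steps, so the search in [gdist] succeeds and does
    not return its default. *)
Lemma walk_gdist x y : connect (adj F) x y -> walk F (gdist F x y) x y.
Proof.
move=> /connectP[p0 hp0 yE]; case: (shortenP hp0) yE => p hp up _ yE.
have sp : (size p < t)%N.
  by have := max_card (mem (x :: p)); rewrite (card_uniqP up) card_ord.
have hk : walk F (size p) x y by apply/walkP; exists p.
have hh : has (fun k => walk F k x y) (iota 0 t).
  by apply/hasP; exists (size p); rewrite // mem_iota.
have := nth_find 0%N hh; rewrite nth_iota ?add0n //.
by move: hh; rewrite has_find size_iota.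
Qed.

Lemma gdist_sym x y : graph_connected F -> gdist F x y = gdist F y x.
Proof.
by move=> [_ conn]; apply/eqP; rewrite eqn_leq !gdist_le // walk_sym // walk_gdist.
Qed.

(** Serves to bound distances from below by a potential. *)
Lemma walk_lipschitz (h : 'I_t -> nat) k x y :
  (forall a b, adj F a b -> (h a <= (h b).+1)%N) -> walk F k x y ->
  (h x <= h y + k)%N.
Proof.
move=> hh /walkP[p [<- hp <-]]; elim: p x hp => [|a p IH] x /=; first by rewrite addn0.
by move=> /andP[xa /IH]; have := hh _ _ xa; lia.
Qed.

Lemma gdist_diameter x y : (gdist F x y <= diameter F)%N.
Proof.
apply: (@leq_trans (\max_(y < t) gdist F x y)).
  exact: (@leq_bigmax _ (fun y => gdist F x y)).
exact: (@leq_bigmax _ (fun x => \max_(y < t) gdist F x y)).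
Qed.

Definition leaf u := forall x y, adj F u x -> adj F u y -> x = y.
Definition colouring (c : 'I_t -> bool) := forall x y, adj F x y -> c x != c y.

Lemma height_colouring (h : 'I_t -> nat) :
  (forall x y, adj F x y -> h x = (h y).+1 \/ h y = (h x).+1) ->
  colouring (fun x => odd (h x)).
Proof. by move=> hh x y /hh[]->; rewrite /=; case: (odd _). Qed.

(** Root the tree at [y], so that height is distance to [y]. A higher neighbour of [x] would exceed
    the diameter, and only one neighbour can be lower. *)
Lemma diametral_leaf x y : tree F -> gdist F x y = diameter F -> leaf x.
Proof.
move=> hT hd; have [[_ conn] _] := hT.
have [h [h0 h1 h2 h3]] := tree_height y hT.
have hg v : gdist F v y = h v.
  apply/eqP; rewrite eqn_leq gdist_le //=.
  have := @walk_lipschitz h _ _ _ _ (walk_gdist (conn v y)); rewrite h0 add0n; apply.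
  by move=> a b /h1[] ->; lia.
have lo a : adj F x a -> (h a < h x)%N.
  move=> /h1; have := gdist_diameter a y; rewrite -hd !hg => h4 [] h5; lia.
by move=> a b xa xb; apply: (h2 x) => //; apply: lo.
Qed.

Lemma odd_diameter_leaves : tree F -> odd (diameter F) ->
  exists (c : 'I_t -> bool) u v, [/\ colouring c, leaf u, leaf v & c u != c v].
Proof.
move=> hT od; have [[t0 conn] _] := hT.
have cI : (0 < #|'I_t|)%N by rewrite card_ord.
have [x hx] := @bigop.eq_bigmax _ (fun x => \max_(y < t) gdist F x y) cI.
have [y hy] := @bigop.eq_bigmax _ (fun y => gdist F x y) cI.
have hd : gdist F x y = diameter F by rewrite /diameter hx hy.
have [h [h0 h1 _ h3]] := tree_height y hT.
exists (fun v => odd (h v)), x, y; split.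
- exact: height_colouring.
- exact: diametral_leaf hd.
- by apply: (@diametral_leaf _ x hT); rewrite gdist_sym //; case: hT.
suff -> : h x = diameter F by rewrite h0 od.
rewrite -hd; apply/eqP; rewrite eqn_leq gdist_le // andbT.
have := @walk_lipschitz h _ _ _ _ (walk_gdist (conn x y)); rewrite h0 add0n; apply.
by move=> a b /h1[] ->; lia.
Qed.

Lemma tree_colouring : tree F -> exists c, colouring c.
Proof.
move=> hT; have [[t0 _] _] := hT.
have [h [_ h1 _ _]] := tree_height (Ordinal t0) hT.
by exists (fun x => odd (h x)); apply: height_colouring.
Qed.

End Distances.

(** * Placing a colour class in [W] *)

Section Classes.
Variables (t n : nat) (F : graph t) (G : graph n) (c : 'I_t -> bool).
Hypothesis hc : colouring F c.
Hypothesis freeF : graph_free F G.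
Implicit Type W : {set 'I_n}.

Definition colour_class (b : bool) : {set 'I_t} := [set x | c x == b].

Lemma card_colour_class b : (#|colour_class b| + #|colour_class (~~ b)| = t)%N.
Proof.
rewrite -[RHS]card_ord -(cardsC (colour_class b)); congr (_ + #|pred_of_set _|)%N.
by apply/setP => x; rewrite !inE; case: (c x) b => -[].
Qed.

(** Otherwise one class embeds into [W] and the other into the common neighbourhood, with no further
    edge to realise. *)
Lemma free_common_lt b W : (0 < t)%N -> (#|colour_class b| <= #|W|)%N ->
  (#|common G W| < t)%N.
Proof.
move=> t0 bW; rewrite ltnNge; apply/negP => tC.
have /card_gt0P[v _] : (0 < #|common G W|)%N by apply: leq_trans tC.
apply: freeF; apply: (@contains_bipartite _ _ F G (colour_class b) set0 W (common G W) (fun=> v)) => //.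
- by move=> w z; apply: adj_common.
- by move=> x y; rewrite !inE => /eqP xb /eqP yb; apply/negP => /hc; rewrite xb yb eqxx.
- by rewrite sub0set.
- by move=> x y; rewrite inE.
- by move=> x; rewrite inE.
by move=> x y /hc; rewrite !inE; case: (c x); case: (c y); case: b {bW}.
Qed.

(** Without [u] its class fits into [W]; then [u] goes to [a] and its neighbour to [b], and the edge
    at [u] is the only one avoiding [A]. *)
Lemma leaf_no_edge u W a b : leaf F u -> (#|colour_class (c u)| <= #|W|.+1)%N ->
  (t <= #|common G W|)%N -> a \in common G W -> b \in common G W -> ~~ adj G a b.
Proof.
move=> lu uW tC aC bC; apply/negP => ab; apply: freeF.
have ba : (b == a) = false by apply: contraTF ab => /eqP ->; rewrite adj_irr.
pose A := colour_class (c u) :\ u.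
pose P := [set z | (z == u) || adj F u z].
pose g z := if z == u then a else b.
apply: (@contains_bipartite _ _ F G A P W (common G W) g) => //.
- by move=> w z; apply: adj_common.
- by move: uW; rewrite (cardsD1 u) inE eqxx.
- move=> x y; rewrite !inE => /andP[_ /eqP xb] /andP[_ /eqP yb].
  by apply/negP => /hc; rewrite xb yb eqxx.
- apply/subsetP => z; rewrite !inE negb_and negbK => /orP[->//|/hc].
  by rewrite eq_sym => ->; rewrite orbT.
- move=> x y; rewrite !inE /g; case: eqVneq => [->|_] /= ux; case: eqVneq => [->|_] //= uy.
  + by move=> e; rewrite -e eqxx in ba.
  + by move=> e; rewrite e eqxx in ba.
  by move=> _; apply: lu.
- by move=> x _; rewrite /g; case: ifP.
move=> x y xy; rewrite !inE /g !negb_and !negbK.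
case: (eqVneq x u) xy => [->|xu] xy /=.
  have yu : (y == u) = false by apply: contraTF xy => /eqP ->; rewrite adj_irr.
  by rewrite yu xy.
case: (eqVneq y u) xy => [->|yu] xy /=; first by rewrite adj_sym xy adj_sym ab.
by have := hc xy; case: (c x); case: (c y); case: (c u).
Qed.

End Classes.

(** The smaller colour class has at most [k.+1] vertices, so [free_common_lt] applies to [Y]. *)
Lemma free_bipartite_free (t n k : nat) (F : graph t) (G : graph n) : tree F ->
  graph_free F G -> (t <= 2 * k + 3)%N -> bipartite_free G k t.
Proof.
move=> hT hF tk Y kY; have [c hc] := tree_colouring hT; have [[t0 _] _] := hT.
have h : (#|colour_class c true| + #|colour_class c false| = t)%N :=
  card_colour_class c true.
have [h1|h1] := leqP #|colour_class c true| k.+1.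
  exact: (free_common_lt hc hF t0 (leq_trans h1 kY)).
apply: (free_common_lt (b := false) hc hF t0); apply: leq_trans kY.
by lia.
Qed.

(** If the class of [u] has more than [k.+1] vertices, the other has at most [k] and fits into [W]
    whole. *)
Lemma leaf_even_no_edge (t n k : nat) (F : graph t) (G : graph n) u
    (W : {set 'I_n}) a b : tree F -> graph_free F G -> leaf F u ->
  (t <= 2 * k + 2)%N -> #|W| = k -> (t <= #|common G W|)%N ->
  a \in common G W -> b \in common G W -> ~~ adj G a b.
Proof.
move=> hT hF lu tk cW tC aC bC.
have [c hc] := tree_colouring hT; have [[t0 _] _] := hT.
have h := card_colour_class c (c u).
have [h1|h1] := leqP #|colour_class c (c u)| k.+1.
  by apply: (leaf_no_edge hc hF lu _ tC aC bC); rewrite cW.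
have : (#|common G W| < t)%N; last by rewrite ltnNge tC.
by apply: (free_common_lt (b := ~~ c u) hc hF t0); rewrite cW; lia.
Qed.

(** Each class contains a leaf, and one of them has at most [k.+1] vertices. *)
Lemma odd_diameter_no_edge (t n k : nat) (F : graph t) (G : graph n)
    (W : {set 'I_n}) a b : tree F -> graph_free F G -> odd (diameter F) ->
  (t <= 2 * k + 3)%N -> #|W| = k -> (t <= #|common G W|)%N ->
  a \in common G W -> b \in common G W -> ~~ adj G a b.
Proof.
move=> hT hF od tk cW tC aC bC.
have [c [u [v [hc lu lv uv]]]] := odd_diameter_leaves hT od.
have h := card_colour_class c (c u).
have [h1|h1] := leqP #|colour_class c (c u)| k.+1.
  by apply: (leaf_no_edge hc hF lu _ tC aC bC); rewrite cW.
apply: (leaf_no_edge hc hF lv _ tC aC bC); rewrite cW.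
have -> : c v = ~~ c u by case: (c u) (c v) uv => -[].
by lia.
Qed.

(** * Trees given by a parent function, and spiders *)

Section ParentTrees.
Variables (t : nat) (F : graph t) (par : nat -> nat).
Hypothesis par_lt : forall i, (0 < i)%N -> (par i < i)%N.
Hypothesis adjE : forall x y : 'I_t, adj F x y =
  ((0 < x)%N && (y == par x :> nat)) || ((0 < y)%N && (x == par y :> nat)).

Lemma parent_adj (x y : 'I_t) : adj F x y -> (y <= x)%N -> y = par x :> nat.
Proof.
rewrite adjE => /orP[/andP[_ /eqP //]|/andP[y0 /eqP ->]].
by have := par_lt y0; lia.
Qed.

Lemma parent_tree : (0 < t)%N -> tree F.
Proof.
move=> t0; split; first split => //.
  have root (x : 'I_t) : connect (adj F) x (Ordinal t0).
    have [m] := ubnP (x : nat); elim: m x => // m IH x xm.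
    have [x0|x0] := posnP x.
      by have -> : x = Ordinal t0 by apply: val_inj.
    have hx := par_lt x0; have pt := ltn_trans hx (ltn_ord x).
    apply: (@connect_trans _ _ (Ordinal pt)); last by apply: IH => /=; lia.
    by apply: connect1; rewrite adjE /= x0 eqxx.
  move=> x y; apply: connect_trans (root x) _.
  by rewrite (sym_connect_sym (@adj_sym _ F)).
(* The largest vertex of a cycle has both its cycle neighbours equal to its parent. *)
move=> c /andP[cyc uc]; rewrite ltnNge; apply/negP => c3.
have [z zc] : exists z, z \in c by case: c c3 {cyc uc} => // z c _; exists z; rewrite mem_head.
pose m := [arg max_(i > z in c) (i : nat)].
have [mc mmax] : m \in c /\ forall j, j \in c -> (j <= m)%N.
  by rewrite /m; case: arg_maxnP => //.
have [i s ri] := rot_to mc.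
have cyc' : cycle (adj F) (m :: s) by rewrite -ri rot_cycle.
have uc' : uniq (m :: s) by rewrite -ri rot_uniq.
have sc : size (m :: s) = size c by rewrite -ri size_rot.
have mem j : j \in m :: s -> (j <= m)%N by rewrite -ri mem_rot; apply: mmax.
case: s {ri} cyc' uc' sc mem => [|a s] cyc' uc' sc mem; first by move: c3; rewrite -sc.
move: cyc'; rewrite /= rcons_path => /and3P[ma _ bm].
have pa := parent_adj ma (mem a (mem_behead (s := m :: a :: s) (mem_head a s))).
have bI : last a s \in m :: a :: s by rewrite inE mem_last orbT.
rewrite adj_sym in bm; have pb := parent_adj bm (mem _ bI).
have ab : a = last a s by apply: val_inj; rewrite /= pa pb.
case: s sc uc' ab {mem bm bI pb} => [|b s] sc uc' ab; first by move: c3; rewrite -sc.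
by move: uc'; rewrite /= ab /= mem_last /= andbF.
Qed.

End ParentTrees.

(* The spider with a leg of length [d - 2], legs of length two and, when
   [l - d] is even, one leg of length one, all attached to the vertex [0]. *)
Definition spider_par (d i : nat) : nat :=
  if (i <= d - 2)%N || odd (i - (d - 1)) then i.-1 else 0%N.

Definition spider_adj (l d : nat) : rel 'I_l := fun x y =>
  ((0 < x)%N && (y == spider_par d x :> nat))
  || ((0 < y)%N && (x == spider_par d y :> nat)).

Lemma spider_par_lt d i : (0 < i)%N -> (spider_par d i < i)%N.
Proof. by rewrite /spider_par; case: ifP; lia. Qed.

Lemma spider_sym l d : symmetric (@spider_adj l d).
Proof. by move=> x y; rewrite /spider_adj orbC. Qed.

Lemma spider_irr l d : irreflexive (@spider_adj l d).
Proof.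
move=> x; rewrite /spider_adj orbb; apply/negP => /andP[x0 /eqP e].
by have := spider_par_lt d x0; rewrite -e ltnn.
Qed.

Definition spider l d : graph l := Graph (@spider_sym l d) (@spider_irr l d).

Section Spider.
Variables (l d : nat).
Hypothesis hd : (4 <= d <= l - 1)%N.
Local Notation F := (spider l d).

Let dl : (d < l)%N. Proof. by lia. Qed.
Let l0 : (0 < l)%N. Proof. by lia. Qed.

Lemma spider_tree : tree F.
Proof. exact: (@parent_tree _ F (spider_par d) (@spider_par_lt d)). Qed.

Lemma spider_adj_par (x y : 'I_l) : (0 < x)%N -> y = spider_par d x :> nat -> adj F x y.
Proof. by move=> x0 e; rewrite /= /spider_adj x0 -e eqxx. Qed.

Definition spider_height (i : nat) : nat :=
  if (i <= d - 2)%N then i else if odd (i - (d - 1)) then 2 else 1.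

Lemma spider_walk_root (x : 'I_l) : walk F (spider_height x) x (Ordinal l0).
Proof.
have [m] := ubnP (x : nat); elim: m x => // m IH x xm.
have [x0|x0] := posnP x.
  have -> : x = Ordinal l0 by apply: val_inj.
  by rewrite /spider_height /= walk0.
have px := spider_par_lt d x0; have pl := ltn_trans px (ltn_ord x).
have -> : spider_height x = (spider_height (Ordinal pl)).+1.
  rewrite /spider_height /= /spider_par; move: hd => ?.
  case: (leqP x (d - 2)) => h1 /=; first by rewrite (_ : x.-1 <= d - 2)%N; lia.
  case: (boolP (odd _)) => h2; last by rewrite leq0n.
  rewrite (_ : (x.-1 <= d - 2)%N = false); last by lia.
  by rewrite (_ : odd (x.-1 - (d - 1)) = false) //; lia.
apply: walk_cons (IH (Ordinal pl) _); last by rewrite /=; lia.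
exact: spider_adj_par.
Qed.

Lemma spider_walk_leg (x y : 'I_l) : (y <= x <= d - 2)%N -> walk F (x - y) x y.
Proof.
move=> /andP[yx xd]; move e : (x - y)%N => m; elim: m x yx xd e => [|m IH] x yx xd e.
  have -> : x = y by apply: val_inj => /=; lia.
  exact: walk0.
have pl : (x.-1 < l)%N by have := ltn_ord x; lia.
apply: (@walk_cons _ _ _ _ (Ordinal pl)); last by apply: IH => /=; lia.
by apply: spider_adj_par; rewrite /= /spider_par ?xd //; lia.
Qed.

(** Two vertices of the long leg are joined along it, any other pair through the centre; [4 <= d]
    covers two short legs. A potential gives the lower bound. *)
Lemma spider_diameter : diameter F = d.
Proof.
apply/eqP; rewrite eqn_leq; apply/andP; split.
  apply/bigmax_leqP => x _; apply/bigmax_leqP => y _.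
  have [/andP[hx hy]|h] := boolP ((x <= d - 2)%N && (y <= d - 2)%N).
    have [yx|xy] := leqP y x.
      by apply: leq_trans (gdist_le (spider_walk_leg _)) _; lia.
    by apply: leq_trans (gdist_le (walk_sym (spider_walk_leg _))) _; lia.
  have w := walk_cat (spider_walk_root x) (walk_sym (spider_walk_root y)).
  apply: leq_trans (gdist_le w) _.
  by move: h; rewrite /spider_height; do ?case: ifP => ?; move: hd; lia.
(* [phi] rises from 0 at the tip [d] of a short leg to [d] at the end [d - 2] of the long leg. *)
pose phi i := if (i <= d - 2)%N then (i + 2)%N else if odd (i - (d - 1)) then 0%N else 1%N.
have lip (x y : 'I_l) : adj F x y -> (phi x <= (phi y).+1)%N /\ (phi y <= (phi x).+1)%N.
  wlog : x y / (0 < x)%N && (y == spider_par d x :> nat).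
    move=> hw xy; have := xy; rewrite /= /spider_adj => /orP[h|h].
      exact: hw.
    by rewrite adj_sym in xy; have [] := hw _ _ h xy.
  move=> /andP[x0 /eqP ->] _; rewrite /phi /spider_par; move: hd => ?.
  case: (leqP x (d - 2)) => h1 /=; first by rewrite (_ : (x.-1 <= d - 2)%N); lia.
  case: (boolP (odd _)) => h2; last by rewrite leq0n.
  rewrite (_ : (x.-1 <= d - 2)%N = false); last by lia.
  by rewrite (_ : odd (x.-1 - (d - 1)) = false) //; lia.
have xl : (d - 2 < l)%N by lia.
have [[_ conn] _] := spider_tree.
apply: leq_trans (gdist_diameter F (Ordinal xl) (Ordinal dl)).
have := walk_lipschitz (fun a b h => (lip a b h).1) (walk_gdist (conn (Ordinal xl) (Ordinal dl))).
rewrite /phi /= leqnn (_ : (d <= d - 2)%N = false); last by move: hd; lia.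
by rewrite (_ : odd (d - (d - 1))) //; move: hd; lia.
Qed.

Lemma spider_leaf : exists u, leaf F u.
Proof.
have ll : (l - 1 < l)%N by lia.
exists (Ordinal ll) => x y.
have h (z : 'I_l) : adj F (Ordinal ll) z -> z = spider_par d (l - 1) :> nat.
  move=> uz; apply: (@parent_adj _ F _ (@spider_par_lt d) _ (Ordinal ll)) => //=.
  by have := ltn_ord z; lia.
by move=> /h hx /h hy; apply: val_inj; rewrite /= hx hy.
Qed.

End Spider.

(** * Matchings and why the extremal graphs contain no spider *)

Lemma card_le_inj (T : finType) (A : {set T}) (k : nat) (f : T -> nat) :
  {in A &, injective f} -> (forall x, x \in A -> (f x < k)%N) -> (#|A| <= k)%N.
Proof.
move=> fI fk; rewrite cardE -(size_map f) -(size_iota 0 k); apply: uniq_leq_size.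
  by rewrite map_inj_in_uniq ?enum_uniq // => x y; rewrite !mem_enum; apply: fI.
by move=> z /mapP[x]; rewrite mem_enum mem_iota => /fk h ->.
Qed.

(** Choosing a covered end of each of the [k.+1] disjoint edges gives [k.+1] distinct labels below
    [k]; in [Sgraph] these labels are the clique. *)
Lemma matching_not_covered (l n k : nat) (f : 'I_l -> 'I_n) (u v : 'I_k.+1 -> 'I_l) :
  injective f -> (forall i, (f (u i) < k)%N || (f (v i) < k)%N) ->
  (forall i j, i != j -> [&& u i != u j, u i != v j & v i != v j]) -> False.
Proof.
move=> fI cov disj.
pose e i := if (f (u i) < k)%N then u i else v i.
have ek i : (f (e i) < k)%N.
  by rewrite /e; case: ifPn (cov i) => // /negbTE ->.
have eI : injective e.
  move=> i j; rewrite /e => eij; apply/eqP; apply: contraT => ij.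
  have /and3P[h1 h2 h3] := disj _ _ ij.
  have /and3P[h4 h5 h6] : [&& u j != u i, u j != v i & v j != v i].
    by apply: disj; rewrite eq_sym.
  by move: eij; case: ifP => _; case: ifP => _ eij;
    move: h1 h2 h3 h4 h5 h6; rewrite eij eqxx.
have : (#|[set: 'I_k.+1]| <= k)%N; last by rewrite cardsT card_ord ltnn.
apply: (@card_le_inj _ _ _ (fun i => f (e i))) => // i j _ _.
by move=> /val_inj/fI/eI.
Qed.

Section SpiderFree.
Variables (l d n k : nat).
Hypothesis hd : (4 <= d <= l - 1)%N.
Local Notation F := (spider l d).

Lemma spider_adj_nat a b (ha : (a < l)%N) (hb : (b < l)%N) :
  (0 < a)%N -> b = spider_par d a -> adj F (Ordinal ha) (Ordinal hb).
Proof. exact: (@spider_adj_par l d (Ordinal ha) (Ordinal hb)). Qed.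

Lemma Sadj0_cover (x y : 'I_n) : adj (Sgraph n k 0) x y -> (x < k)%N || (y < k)%N.
Proof. by rewrite /= /Sadj ltn0 andbF orbF => /andP[]. Qed.

Lemma spider_even_free : l = (2 * k + 2)%N -> graph_free F (Sgraph n k 0).
Proof.
move=> lk [f fI fA].
(* A perfect matching. For odd [d] it pairs [2i] with [2i + 1]; for even [d] it pairs [2i + 1] with
   [2i + 2], and the last index pairs the centre with [l - 1], the leg of length one. *)
pose u (i : 'I_k.+1) : nat :=
  (if odd d then 2 * i else if i == k :> nat then 0 else 2 * i + 1)%N.
pose v (i : 'I_k.+1) : nat :=
  (if odd d then 2 * i + 1 else if i == k :> nat then l - 1 else 2 * i + 2)%N.
have hu i : (u i < l)%N by rewrite /u; have := ltn_ord i; do ?case: ifP => ?; lia.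
have hv i : (v i < l)%N by rewrite /v; have := ltn_ord i; do ?case: ifP => ?; lia.
apply: (@matching_not_covered l n k f (fun i => Ordinal (hu i)) (fun i => Ordinal (hv i))) => //.
  move=> i; apply: Sadj0_cover; apply: fA; rewrite adj_sym.
  apply: spider_adj_nat; rewrite /u /v /spider_par; have := ltn_ord i; move: hd;
    do ?case: ifP => ?; lia.
move=> i j; rewrite -!val_eqE /= /u /v; have := ltn_ord i; have := ltn_ord j; move: hd.
by do ?case: ifP => ?; lia.
Qed.

Lemma Sadj1_cover (x y : 'I_n) : adj (Sgraph n k 1) x y ->
  [|| (x < k)%N, (y < k)%N | [&& (x <= k.+1)%N, (y <= k.+1)%N & x != y]].
Proof.
rewrite /= /Sadj => /andP[xy /or3P[->//|->|/andP[/eqP e h]]]; first by rewrite orbT.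
by rewrite xy; apply/or3P; constructor 3; rewrite andbT; lia.
Qed.

(** All legs are even, so the spider without its centre has a perfect matching of [k.+1] edges. One
    of them must go to the extra edge; a second matching of the same size omits that edge, so it is
    covered by the clique. *)
Lemma spider_odd_free : l = (2 * k + 3)%N -> ~~ odd d ->
  graph_free F (Sgraph n k 1).
Proof.
move=> lk od [f fI fA].
pose u (i : 'I_k.+1) : nat := (2 * i + 1)%N.
have hu i : (u i < l)%N by rewrite /u; have := ltn_ord i; lia.
have hw (i : 'I_k.+1) : (2 * i + 2 < l)%N by have := ltn_ord i; lia.
have [/forallP cov|/forallPn[i0]] := boolP [forall i : 'I_k.+1,
    (f (Ordinal (hu i)) < k)%N || (f (Ordinal (hw i)) < k)%N].
  apply: (@matching_not_covered l n k f (fun i => Ordinal (hu i)) (fun i => Ordinal (hw i))) => //.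
  by move=> i j; rewrite -!val_eqE /= /u; lia.
rewrite negb_or -!leqNgt => /andP[k1 k2].
(* The edge at [i0] is not covered, hence is mapped to the extra edge; flip the
   matching along the leg from the root so that it avoids this edge. *)
pose flip (i : 'I_k.+1) := (i == i0) || ((2 * i0 + 1 <= d - 2)%N && (i <= i0)%N).
pose v (i : 'I_k.+1) : nat := if flip i then spider_par d (2 * i + 1) else (2 * i + 2)%N.
have hv i : (v i < l)%N.
  rewrite /v; case: ifP => _ //.
  by apply: ltn_trans (hu i); apply: spider_par_lt; rewrite addn1.
have e0 : adj (Sgraph n k 1) (f (Ordinal (hw i0))) (f (Ordinal (hu i0))).
  apply: fA; apply: spider_adj_nat; rewrite /u /spider_par; move: hd;
    do ?case: ifP => ?; lia.
have /or3P := Sadj1_cover e0; rewrite (leq_gtF k1) (leq_gtF k2) => -[//|//|/and3P[k3 k4 _]].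
apply: (@matching_not_covered l n k f (fun i => Ordinal (hu i)) (fun i => Ordinal (hv i))) => //.
  (* An uncovered edge of the new matching would also go to the extra edge, hence equal the omitted
     one. *)
  move=> i; apply/negPn; rewrite negb_or -!leqNgt; apply/negP => /andP[k5 k6].
  have e1 : adj (Sgraph n k 1) (f (Ordinal (hu i))) (f (Ordinal (hv i))).
    apply: fA; have hi := ltn_ord i; case fl : (flip i).
      by apply: spider_adj_nat; rewrite /u /v ?fl // addn1.
    rewrite adj_sym; apply: spider_adj_nat; rewrite /v fl /u /spider_par; move: hd;
      do ?case: ifP => ?; lia.
  have /or3P := Sadj1_cover e1; rewrite (leq_gtF k5) (leq_gtF k6) => -[//|//|/and3P[k7 k8 fne]].
  have ne : Ordinal (hw i0) != Ordinal (hu i0) by rewrite -val_eqE /= /u; lia.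
  have fne0 : f (Ordinal (hw i0)) != f (Ordinal (hu i0)) by rewrite (inj_eq fI).
  have [/fI/(congr1 val)/= h|h] : f (Ordinal (hu i)) = f (Ordinal (hw i0)) \/
      f (Ordinal (hu i)) = f (Ordinal (hu i0)).
    have [h|h] := eqVneq (f (Ordinal (hu i)) : nat) (f (Ordinal (hw i0)) : nat).
      by left; apply: val_inj.
    by right; apply: val_inj => /=; move: h fne0; rewrite -val_eqE /=; lia.
  - by move: h; rewrite /u; lia.
  have i0E : i = i0.
    by move: h => /fI/(congr1 val) /=; rewrite /u => h; apply: val_inj => /=; lia.
  have : f (Ordinal (hv i)) = f (Ordinal (hw i0)).
    apply: val_inj => /=; move: fne0 fne; rewrite -!val_eqE /= h; lia.
  move=> /fI/(congr1 val) /=; rewrite /v /flip i0E eqxx /=.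
  have : (0 < 2 * i0 + 1)%N by rewrite addn1.
  by move=> /(spider_par_lt d); lia.
move=> i j; rewrite -!val_eqE /= /u /v /flip -!val_eqE /= /spider_par.
have := ltn_ord i; have := ltn_ord j; have := ltn_ord i0; move: hd.
by do ?case: ifP => ?; lia.
Qed.

End SpiderFree.

(** * Spiders of odd order and edges inside [C] *)

Section SpiderEdges.
Variables (l d n k : nat) (G : graph n) (W : {set 'I_n}).
Hypothesis hd : (4 <= d <= l - 1)%N.
Hypothesis lk : l = (2 * k + 3)%N.
Hypothesis od : ~~ odd d.
Hypothesis cW : #|W| = k.
Hypothesis lC : (l <= #|common G W|)%N.
Local Notation F := (spider l d).
Hypothesis freeF : graph_free F G.
Local Notation C := (common G W).

(** As [d] is even, the short legs start at odd labels. *)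
Lemma spider_parity : colouring F (fun x => odd x).
Proof.
move=> x y; rewrite /= /spider_adj /spider_par => /orP[]/andP[h0 /eqP ->];
  move: hd od; case: ifP => ?; lia.
Qed.

(** There are [k.+1] odd labels. All but 1 go to [W], and the path on the labels 0, 1, 2 goes to
    [a], [b], [c]. *)
Lemma spider_no_path3 a b c : a \in C -> b \in C -> c \in C -> a != c ->
  adj G a b -> adj G b c -> False.
Proof.
move=> aC bC cC ac ab bc; apply: freeF.
have nab : a != b by apply: contraTneq ab => ->; rewrite adj_irr.
have nbc : b != c by apply: contraTneq bc => ->; rewrite adj_irr.
pose A := [set x : 'I_l | odd x & x != 1%N :> nat].
pose P := [set x : 'I_l | (x <= 2)%N].
pose g (x : 'I_l) := if x == 0%N :> nat then a else if x == 1%N :> nat then b else c.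
apply: (@contains_bipartite _ _ F G A P W C g) => //.
- by move=> w v; apply: adj_common.
- rewrite cW; apply: (@card_le_inj _ A k (fun x => (x./2).-1)) => [x y|x].
    by rewrite !inE => h1 h2 h3; apply: val_inj => /=; lia.
  by rewrite inE; have := ltn_ord x; lia.
- move=> x y; rewrite !inE => /andP[ox _] /andP[oy _]; apply/negP => /spider_parity.
  by rewrite /= ox oy.
- by apply/subsetP => x; rewrite !inE; lia.
- move=> x y; rewrite !inE /g => hx hy.
  case: eqP => x0; case: eqP => y0; do ?case: eqP => ?; move=> e; apply: val_inj => /=;
    try lia; by move: ac nab nbc; rewrite e eqxx.
- by move=> x _; rewrite /g; do ?case: ifP.
have key (x y : 'I_l) : (0 < x)%N && (y == spider_par d x :> nat) ->
    x \notin A -> y \notin A -> [/\ x \in P, y \in P, adj G (g x) (g y) & adj G (g y) (g x)].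
  rewrite !inE /spider_par => /andP[x0 /eqP yE] xA yA.
  have [[xE yE']|[xE yE']] : (x = 1%N :> nat /\ y = 0%N :> nat) \/
      (x = 2%N :> nat /\ y = 1%N :> nat).
    by move: xA yA yE hd od; case: ifP => ?; lia.
  - by rewrite /g xE yE' /= ab adj_sym ab.
  by rewrite /g xE yE' /= bc adj_sym bc.
move=> x y /orP[] h xA yA; first by have [] := key _ _ h xA yA.
by have [] := key _ _ h yA xA.
Qed.

(** Of the [k + 2] even labels, all but the leg ends [d - 2] and [l - 1] go to [W]; the last edges
    of these two legs go to the two given edges. *)
Lemma spider_no_2edges a b c e : a \in C -> b \in C -> c \in C -> e \in C ->
  uniq [:: a; b; c; e] -> adj G a b -> adj G c e -> False.
Proof.
move=> aC bC cC eC un ab ce; apply: freeF.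
pose A := [set x : 'I_l | [&& ~~ odd x, x != (d - 2)%N :> nat & x != (l - 1)%N :> nat]].
pose P := [set x : 'I_l | [|| x == (d - 3)%N :> nat, x == (d - 2)%N :> nat,
  x == (l - 2)%N :> nat | x == (l - 1)%N :> nat]].
pose g (x : 'I_l) := if x == (d - 3)%N :> nat then a else
  if x == (d - 2)%N :> nat then b else if x == (l - 2)%N :> nat then c else e.
apply: (@contains_bipartite _ _ F G A P W C g) => //.
- by move=> w v; apply: adj_common.
- rewrite cW; apply: (@card_le_inj _ A k
    (fun x => if (x < d - 2)%N then x./2 else (x./2).-1)) => [x y|x].
    rewrite !inE => h1 h2 h3; apply: val_inj => /=.
    by move: h3 hd od; do ?case: ifP => ?; lia.
  by rewrite inE; have := ltn_ord x; move: hd od; case: ifP => ?; lia.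
- move=> x y; rewrite !inE => /andP[ox _] /andP[oy _]; apply/negP => /spider_parity.
  by rewrite /= (negbTE ox) (negbTE oy).
- by apply/subsetP => x; rewrite !inE; move: hd od; lia.
- move=> x y; rewrite !inE /g => hx hy.
  do ?case: eqP => ?; move=> ee; apply: val_inj => /=; try lia;
    by move: un; rewrite /= !inE ee eqxx ?orbT ?andbF.
- by move=> x _; rewrite /g; do ?case: ifP.
have key (x y : 'I_l) : (0 < x)%N && (y == spider_par d x :> nat) ->
    x \notin A -> y \notin A -> [/\ x \in P, y \in P, adj G (g x) (g y) & adj G (g y) (g x)].
  rewrite !inE /spider_par => /andP[x0 /eqP yE] xA yA; have xl := ltn_ord x.
  have [[xE yE']|[xE yE']] : (x = (d - 2)%N :> nat /\ y = (d - 3)%N :> nat) \/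
      (x = (l - 1)%N :> nat /\ y = (l - 2)%N :> nat).
    by move: xA yA yE hd od; case: ifP => ?; lia.
  - rewrite /g xE yE' /= !eqxx ?orbT (_ : (d - 2 == d - 3)%N = false); last by move: hd; lia.
    by rewrite ab adj_sym ab.
  rewrite /g xE yE' /= !eqxx ?orbT.
  rewrite (_ : (l - 1 == d - 3)%N = false); last by move: hd; lia.
  rewrite (_ : (l - 1 == d - 2)%N = false); last by move: hd; lia.
  rewrite (_ : (l - 1 == l - 2)%N = false); last by move: hd; lia.
  rewrite (_ : (l - 2 == d - 3)%N = false); last by move: hd; lia.
  rewrite (_ : (l - 2 == d - 2)%N = false); last by move: hd; lia.
  by rewrite ce adj_sym ce.
move=> x y /orP[] h xA yA; first by have [] := key _ _ h xA yA.
by have [] := key _ _ h yA xA.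
Qed.

(** Two different edges inside [C] either form a path or are disjoint, and both cases are
    excluded. *)
Lemma spider_one_edge a b c e : a \in C -> b \in C -> c \in C -> e \in C ->
  adj G a b -> adj G c e -> (c == a) && (e == b) || (c == b) && (e == a).
Proof.
move=> aC bC cC eC ab ce.
have nab : a != b by apply: contraTneq ab => ->; rewrite adj_irr.
have nce : c != e by apply: contraTneq ce => ->; rewrite adj_irr.
have P3 := spider_no_path3.
have [ca|ca] := eqVneq c a.
  subst c; have [//|eb] := eqVneq e b.
  by rewrite adj_sym in ab; case: (P3 b a e); rewrite // eq_sym.
have [cb|cb] := eqVneq c b.
  subst c; have [//|ea] := eqVneq e a.
  by case: (P3 a b e); rewrite // eq_sym.
have [ea|ea] := eqVneq e a; first by subst e; case: (P3 c a b).
have [eb|eb] := eqVneq e b.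
  by subst e; rewrite adj_sym in ab; case: (P3 c b a).
case: (@spider_no_2edges a b c e) => //.
by rewrite /= !inE !negb_or nab nce ![_ == c]eq_sym ca cb ![_ == e]eq_sym ea eb.
Qed.

End SpiderEdges.

(** * Identifying the join with [Sgraph] *)

Lemma numbering (n : nat) (W : {set 'I_n}) (q : seq 'I_n) : uniq q ->
  (forall x, x \in q -> x \notin W) -> exists f : 'I_n -> 'I_n, [/\ bijective f,
    (forall x, (f x < #|W|)%N = (x \in W)) &
    (forall x i, x \notin W -> (f x == (#|W| + i)%N :> nat) && (i < size q)%N =
       (index x q == i) && (i < size q)%N)].
Proof.
move=> uq qW.
(* [f] is the position in this list. The third clause carries [i < size q] because [index] returns
   [size q] off [q]. *)
pose s := enum W ++ q ++ [seq x <- enum 'I_n | (x \notin W) && (x \notin q)].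
have all_s x : x \in s.
  rewrite !mem_cat mem_enum mem_filter mem_enum /= andbT.
  by case: (x \in W); case: (x \in q).
have us : uniq s.
  rewrite !cat_uniq enum_uniq uq filter_uniq ?enum_uniq //= !andbT.
  apply/andP; split; apply/hasPn => x.
    move=> h; apply: contraL h => /=; rewrite mem_enum mem_cat mem_filter => xW.
    by rewrite xW /= orbF; apply: contraL xW; apply: qW.
  by rewrite mem_filter => /andP[/andP[_ ->]].
have ss : size s = n.
  by rewrite -(card_uniqP us) -[RHS]card_ord; apply: eq_card => x; rewrite all_s.
have si x : (index x s < n)%N by rewrite -[X in (_ < X)%N]ss index_mem.
exists (fun x => Ordinal (si x)); split.
- apply: injF_bij => x y /(congr1 val) /= e.
  by rewrite -(nth_index x (all_s x)) e nth_index.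
- move=> x; rewrite /= index_cat mem_enum; case: ifP => xW.
    by rewrite cardE index_mem mem_enum.
  by rewrite -cardE ltnNge leq_addr.
move=> x i xW; rewrite /= index_cat mem_enum (negbTE xW) -cardE eqn_add2l index_cat.
case: ifPn => // xq; case: (ltnP i (size q)) => iq; rewrite ?andbF // !andbT.
by rewrite (memNindex xq) !gtn_eqF // (leq_trans iq) // leq_addr.
Qed.

Section JoinIso.
Variables (n k : nat) (G : graph n) (W : {set 'I_n}).
Hypothesis cW : #|W| = k.
Local Notation C := (common G W).

Lemma join_iso0 : (forall a b, a \in C -> b \in C -> ~~ adj G a b) ->
  iso (join G W) (Sgraph n k 0).
Proof.
move=> hC; have [//|//|f [fB fW _]] := @numbering n W [::].
exists f => // x y; rewrite /= /join_adj /Sadj (inj_eq (bij_inj fB)) -cW !fW.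
rewrite ltn0 andbF; congr (_ && [|| _, _ | _]).
by apply/negP => /and3P[xC yC]; rewrite (negbTE (hC _ _ xC yC)).
Qed.

Lemma join_iso1 a b : a \in C -> b \in C -> adj G a b ->
  (forall c e, c \in C -> e \in C -> adj G c e ->
     (c == a) && (e == b) || (c == b) && (e == a)) ->
  iso (join G W) (Sgraph n k 1).
Proof.
move=> aC bC ab hC.
have nab : a != b by apply: contraTneq ab => ->; rewrite adj_irr.
have aW := common_notin aC; have bW := common_notin bC.
have [||f [fB fW fq]] := @numbering n W [:: a; b].
- by rewrite /= inE nab.
- by move=> x; rewrite !inE => /orP[]/eqP->.
exists f => // x y; rewrite /= /join_adj /Sadj (inj_eq (bij_inj fB)) -cW !fW.
case: (eqVneq x y) => //= xy.
case xW: (x \in W) => //=; case yW: (y \in W) => //=.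
(* The extra edge joins the labels [k] and [k + 1], whose offsets 0 and 1 both halve to 0. *)
have idx z : z \in W = false -> ((f z - #|W|)./2 < 1)%N = (z == a) || (z == b).
  move=> zW; have zn := negbT zW; have := fq z 0%N zn; have := fq z 1%N zn.
  have := fW z; rewrite zW /= [a == z]eq_sym [b == z]eq_sym.
  by case: (z == a); case: (z == b) => /=; lia.
have -> : ((f x - #|W|)./2 == (f y - #|W|)./2) && ((f x - #|W|)./2 < 1)%N =
    ((f x - #|W|)./2 < 1)%N && ((f y - #|W|)./2 < 1)%N by lia.
rewrite !idx //; apply/idP/idP.
  by move=> /and3P[xC yC /(hC _ _ xC yC)] /orP[]/andP[/eqP-> /eqP->]; rewrite !eqxx ?orbT.
move=> /andP[/orP[]/eqP xE /orP[]/eqP yE]; move: xy; rewrite xE yE ?eqxx // => _.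
  by rewrite aC bC ab.
by rewrite aC bC adj_sym ab.
Qed.

End JoinIso.

(** * Uniqueness of the extremal graph *)

Lemma spectral_structure (R : realType) (l k : nat) : (0 < k)%N -> (0 < l)%N ->
  (l <= 2 * k + 3)%N ->
  exists N : nat, forall (n : nat) (G : graph n) (F : graph l), (N <= n)%N ->
    tree F -> graph_free F G -> rho R (Sgraph n k 0) <= rho R G ->
    exists W : {set 'I_n}, [/\ #|W| = k, (l <= #|common G W|)%N &
      rho R (join G W) <= rho R G -> forall u v, adj G u v = adj (join G W) u v].
Proof.
move=> k0 l0 lk; have [N hN] := dominant_set R k0 l0.
exists (N + k + 2)%N => n G F hn hT hF hrho.
have kn : (0 < k < n)%N by lia.
have n0 : (0 < n)%N by lia.
have dG := free_degenerate hT hF; have bG := free_bipartite_free hT hF lk.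
have [x [x01 xz xE]] := perron R G n0.
have r0 : 0 <= rho R G by apply: rho_ge0.
have r2 : k%:R * (n%:R - k%:R) <= rho R G ^+ 2.
  apply: (le_trans (rho_Sgraph_ge R kn)).
  by rewrite ler_sqr ?nnegrE // rho_ge0.
have hNn : (N <= n)%N by lia.
have [W [cW xW xnW lC nbC]] := hN n G x (rho R G) hNn dG bG x01 xz xE r0 r2.
(* The comparison with the join stays a hypothesis: it is checked once the edges inside the common
   neighbourhood are known and identify the join. *)
exists W; split => // hj; apply: (join_eq (T := l) (x := x)) => //.
by rewrite -card_gt0 cW.
Qed.

Lemma iso_adj_eq (n : nat) (G H K : graph n) :
  (forall u v, adj G u v = adj H u v) -> iso H K -> iso G K.
Proof. by move=> e [f fB fA]; exists f => // x y; rewrite e fA. Qed.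

Lemma iso_free (m n : nat) (F : graph m) (G H : graph n) :
  iso G H -> graph_free F H -> graph_free F G.
Proof.
move=> [f fB fA] hF [g gI gA]; apply: hF; exists (f \o g).
  exact: inj_comp (bij_inj fB) gI.
by move=> x y /gA; rewrite fA.
Qed.

(** The hypothesis makes [rho R g] the supremum. Graphs are labelled, so uniqueness means a single
    isomorphism class. *)
Lemma SPEX_unique (R : realType) (m n : nat) (F : graph m) (g : graph n) :
  (0 < n)%N -> graph_free F g ->
  (forall H : graph n, graph_free F H -> rho R g <= rho R H -> iso H g) ->
  SPEX R n F = [set H : graph n | iso H g]%classic.
Proof.
move=> n0 gF hg.
have sE : spex R n F = rho R g.
  apply: le_anti; apply/andP; split.
    apply: ge_sup; first by exists (rho R g), g.
    move=> _ [H HF <-]; have /orP[//|h] := le_total (rho R H) (rho R g).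
    by rewrite (rho_iso R n0 (hg _ HF h)).
  apply: sup_upper_bound; last by exists g.
  split; first by exists (rho R g), g.
  exists (rho R g) => _ [H HF <-]; have /orP[//|h] := le_total (rho R H) (rho R g).
  by rewrite (rho_iso R n0 (hg _ HF h)).
apply/funext => H; apply/propext; split => /=.
  by move=> [HF]; rewrite sE => e; apply: hg => //; rewrite e.
move=> hi; split; first exact: iso_free hi gF.
by rewrite sE; apply: rho_iso.
Qed.

Lemma rho_Sgraph_lt (R : realType) (n k : nat) : (0 < k)%N -> (k + 2 <= n)%N ->
  rho R (Sgraph n k 0) < rho R (Sgraph n k 1).
Proof.
move=> k0 kn; have n0 : (0 < n)%N by lia.
have h1 : (k < n)%N by lia.
have h2 : (k.+1 < n)%N by lia.
apply: (@rho_lt _ _ _ _ (Ordinal n0) (Ordinal h1) (Ordinal h2)).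
- by move=> i j; rewrite /= /Sadj ltn0 andbF orbF => /andP[-> /orP[]->]; rewrite ?orbT.
- by move=> i hi; rewrite /= /Sadj eq_sym hi /= k0.
- by rewrite /= /Sadj -val_eqE /= subnn subSnn ltn_eqF // !orbT.
by rewrite /= /Sadj /= ltnn ltn0 andbF orbF ltnNge leqnSn andbF.
Qed.

Lemma SPEX_spider_even (R : realType) (l d : nat) :
  (4 <= d <= l - 1)%N -> ~~ odd l -> exists N : nat, forall n, (N <= n)%N ->
  SPEX R n (spider l d) = [set H : graph n | iso H (Ggraph n l)]%classic.
Proof.
move=> hd ol; pose k := (l - 2)./2.
have k0 : (0 < k)%N by rewrite /k; lia.
have lk : l = (2 * k + 2)%N by rewrite /k; lia.
have l0 : (0 < l)%N by lia.
have lk3 : (l <= 2 * k + 3)%N by lia.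
have [N hN] := spectral_structure R k0 l0 lk3.
exists N.+1 => n hn; have n0 : (0 < n)%N by lia.
rewrite /Ggraph (negbTE ol) -/k; apply: SPEX_unique => //.
  exact: spider_even_free.
move=> H HF hr; have hT := spider_tree hd; have [u lu] := spider_leaf hd.
have [W [cW lC eqJ]] := hN n H _ (ltnW hn) hT HF hr.
have hi : iso (join H W) (Sgraph n k 0).
  apply: join_iso0 => // a b.
  have lk2 : (l <= 2 * k + 2)%N by lia.
  exact: leaf_even_no_edge hT HF lu lk2 cW lC.
by apply: (iso_adj_eq _ hi); apply: eqJ; rewrite (rho_iso R n0 hi).
Qed.

Lemma SPEX_spider_odd (R : realType) (l d : nat) :
  (4 <= d <= l - 1)%N -> odd l -> ~~ odd d -> exists N : nat, forall n, (N <= n)%N ->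
  SPEX R n (spider l d) = [set H : graph n | iso H (Ggraph n l)]%classic.
Proof.
move=> hd ol od; pose k := (l - 3)./2.
have k0 : (0 < k)%N by rewrite /k; lia.
have lk : l = (2 * k + 3)%N by rewrite /k; lia.
have l0 : (0 < l)%N by lia.
have lk3 : (l <= 2 * k + 3)%N by lia.
have [N hN] := spectral_structure R k0 l0 lk3.
exists (N + k + 2)%N => n hn; have n0 : (0 < n)%N by lia.
have kn : (k + 2 <= n)%N by lia.
have Nn : (N <= n)%N by lia.
have lt01 := rho_Sgraph_lt R k0 kn.
rewrite /Ggraph ol -/k; apply: SPEX_unique => //.
  exact: spider_odd_free.
move=> H HF hr; have hT := spider_tree hd.
have [W [cW lC eqJ]] := hN n H _ Nn hT HF (ltW (lt_le_trans lt01 hr)).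
pose C := common H W.
(* [C] spans at most one edge. Without any, [H] would be [Sgraph n k 0], whose spectral radius is
   too small. *)
have [/existsP[a /existsP[b /and3P[aC bC ab]]]|/existsPn none] :=
    boolP [exists a, exists b, [&& a \in C, b \in C & adj H a b]].
  have hi : iso (join H W) (Sgraph n k 1).
    apply: (join_iso1 cW aC bC ab) => c e cC eC.
    exact: (spider_one_edge hd lk od cW lC HF aC bC cC eC ab).
  by apply: (iso_adj_eq _ hi); apply: eqJ; rewrite (rho_iso R n0 hi).
have hi : iso (join H W) (Sgraph n k 0).
  apply: join_iso0 => // a b aC bC; have /existsPn/(_ b) := none a.
  by rewrite aC bC.
have : rho R H < rho R (Sgraph n k 1); last by rewrite ltNge hr.
suff -> : rho R H = rho R (Sgraph n k 0) by [].
apply: rho_iso => //; apply: (iso_adj_eq _ hi); apply: eqJ.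
by rewrite (rho_iso R n0 hi) ltW // (lt_le_trans lt01).
Qed.

Lemma odd_diameter_contains (R : realType) (l d : nat) : (6 <= l)%N -> odd l -> odd d ->
  exists N : nat, forall (n : nat) (G : graph n), (N <= n)%N ->
    rho R (Sgraph n (l - 3)./2 0) <= rho R G ->
    ~ iso G (Sgraph n (l - 3)./2 0) ->
    forall F : graph l, tree F -> diameter F = d -> contains G F.
Proof.
move=> hl ol od; pose k := (l - 3)./2.
have k0 : (0 < k)%N by rewrite /k; lia.
have l0 : (0 < l)%N by lia.
have lk3 : (l <= 2 * k + 3)%N by rewrite /k; lia.
have [N hN] := spectral_structure R k0 l0 lk3.
exists N.+1 => n G hn; rewrite -/k => hr niso F hT dF; have n0 : (0 < n)%N by lia.
apply: contrapT => HF; apply: niso.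
have [W [cW lC eqJ]] := hN n G _ (ltnW hn) hT HF hr.
have hi : iso (join G W) (Sgraph n k 0).
  apply: join_iso0 => // a b; rewrite -dF in od.
  exact: odd_diameter_no_edge hT HF od lk3 cW lC.
by apply: (iso_adj_eq _ hi); apply: eqJ; rewrite (rho_iso R n0 hi).
Qed.

Local Open Scope classical_set_scope.
Local Open Scope ring_scope.

Theorem theorem1p2 (R : realType) (l d : nat)
    (hl : (6 <= l)%N) (hd : (4 <= d <= l - 1)%N) :
  exists N : nat,
    (~~ odd l || ~~ odd d ->
      exists F : graph l,
        [/\ tree F, diameter F = d &
            forall n : nat, (N <= n)%N ->
              SPEX R n F = [set H : graph n | iso H (Ggraph n l)]]) /\
    (odd l -> odd d ->
      forall (n : nat) (G : graph n), (N <= n)%N ->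
        rho R (Sgraph n (l - 3)./2 0) <= rho R G ->
        ~ iso G (Sgraph n (l - 3)./2 0) ->
        forall F : graph l, tree F -> diameter F = d -> contains G F).
Proof.
have spider_case N : (forall n, (N <= n)%N ->
    SPEX R n (spider l d) = [set H : graph n | iso H (Ggraph n l)]) ->
    exists F : graph l, [/\ tree F, diameter F = d & forall n : nat, (N <= n)%N ->
      SPEX R n F = [set H : graph n | iso H (Ggraph n l)]].
  by move=> hN; exists (spider l d); split; [exact: spider_tree|exact: spider_diameter|].
(* In each parity case the premises of one clause fail, so one threshold suffices. *)
have [ol|ol] := boolP (odd l); last first.
  by have [N hN] := SPEX_spider_even R hd ol; exists N; split => [_|//]; apply: spider_case.
have [od|od] := boolP (odd d); last first.
  by have [N hN] := SPEX_spider_odd R hd ol od; exists N; split => [_|//]; apply: spider_case.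
by have [N hN] := odd_diameter_contains R hl ol od; exists N.
Qed.
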